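(* Over $\mathsf{RCA}_0$ the following are equivalent: (i) $\mathsf{WKL}_0$; (ii) every partial order containing neither $\mathbf{2}\oplus\mathbf{2}$ nor $\mathbf{3}\oplus\mathbf{1}$ is a proper 1-1 interval order; (iii) every partial order containing neither $\mathbf{2}\oplus\mathbf{2}$ nor $\mathbf{3}\oplus\mathbf{1}$ is a proper closed interval order; (iv) every proper interval order is a proper 1-1 interval order; (v) every closed interval order which is also a proper interval order is a proper closed interval order.
   Context: $\mathsf{RCA}_0$ is the base subsystem of second-order arithmetic ($\Delta^0_1$ comprehension, $\Sigma^0_1$ induction); $\mathsf{WKL}_0$ is $\mathsf{RCA}_0$ plus Weak König's Lemma (every infinite tree of finite $0$-$1$ sequences has an infinite path). A partial order $\mathbf{P}=(P,\leq_P)$ is a set $P\subseteq\mathbb{N}$ with a reflexive, transitive, antisymmetric relation; a linear order has any two elements comparable; $p<_P q$ means $p\leq_P q$, $p\ne q$. Given a linear order $\mathbf{L}=(L,\leq_L)$ and $F\subseteq P\times L$, write $F(p)=\{x:(p,x)\in F\}$ and consider: (i1) each $F(p)$ nonempty and convex in $\mathbf{L}$; (i2) $p<_P q$ iff $x<_L y$ for all $x\in F(p),y\in F(q)$; (i3) $F(p)\ne F(q)$ whenever $p\ne q$; (i4) $F(p)\subseteq F(q)$ implies $F(p)=F(q)$. $\mathbf{P}$ is a proper interval order if some $\mathbf{L},F$ satisfy (i1),(i2),(i4), and a proper 1-1 interval order if some satisfy (i1)-(i4). Given a linear order $\mathbf{L}$ and $f_0,f_1:P\to L$ consider: (c1)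 $f_0(p)\leq_L f_1(p)$; (c2) $p<_P q$ iff $f_1(p)<_L f_0(q)$; (c5) $f_0(p)<_L f_0(q)$ iff $f_1(p)<_L f_1(q)$. $\mathbf{P}$ is a closed interval order if some $\mathbf{L},f_0,f_1$ satisfy (c1),(c2), and a proper closed interval order if some satisfy (c1),(c2),(c5). $\mathbf{P}$ does not contain $\mathbf{2}\oplus\mathbf{2}$ if $p_0<_P q_0$, $p_1<_P q_1$ imply $p_0\leq_P q_1$ or $p_1\leq_P q_0$; it does not contain $\mathbf{3}\oplus\mathbf{1}$ if for all $p_0,p_1,p_2,q\in P$, $p_0<_P p_1<_P p_2$ implies $p_0\leq_P q$ or $q\leq_P p_2$. *)

(* Defs.v *)
(** * Second-order arithmetic *)

(** Structures for the two-sorted language of second-order arithmetic. They are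
    Henkin structures: the first-order part may be nonstandard, and [set] need
    not contain all subsets of [num]. Equality is primitive only between
    numbers; two sets are equal when they have the same elements. *)
Record L2_structure := {
  num : Type;
  set : Type;
  zero : num;
  one : num;
  add : num -> num -> num;
  mul : num -> num -> num;
  lt : num -> num -> Prop;
  mem : set -> num -> Prop;
  set_inhabited : inhabited set
}.

Declare Scope l2_scope.
Delimit Scope l2_scope with l2.
Arguments zero {_}.
Arguments one {_}.
Arguments add {_} _ _.
Arguments mul {_} _ _.
Arguments lt {_} _ _.
Arguments mem {_} _ _.
Notation "0" := zero : l2_scope.
Notation "1" := one : l2_scope.
Notation "x + y" := (add x y) : l2_scope.
Notation "x * y" := (mul x y) : l2_scope.
Notation "x < y" := (lt x y) : l2_scope.
Notation "x ∈ X" := (mem X x) (at level 70, no associativity) : l2_scope.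
Open Scope l2_scope.

(** Bounded formulas with number and set parameters. Number variables are de
    Bruijn indices; set variables are never bound. In [f_ball t A] and
    [f_bex t A] the bound [t] lies outside the scope of the quantifier. *)
Inductive term :=
  | t_var (i : nat)
  | t_zero
  | t_one
  | t_add (s t : term)
  | t_mul (s t : term).

Inductive bounded_formula :=
  | f_eq (s t : term)
  | f_lt (s t : term)
  | f_mem (t : term) (k : nat)
  | f_not (A : bounded_formula)
  | f_and (A B : bounded_formula)
  | f_or (A B : bounded_formula)
  | f_imp (A B : bounded_formula)
  | f_ball (t : term) (A : bounded_formula)
  | f_bex (t : term) (A : bounded_formula).

Definition env_cons {T : Type} (x : T) (e : nat -> T) (i : nat) : T :=
  match i with O => x | S j => e j end.

Fixpoint eval {M : L2_structure} (e : nat -> num M) (t : term) : num M :=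
  match t with
  | t_var i => e i
  | t_zero => 0
  | t_one => 1
  | t_add s t => eval e s + eval e t
  | t_mul s t => eval e s * eval e t
  end.

Fixpoint sat {M : L2_structure} (e : nat -> num M) (E : nat -> set M)
    (A : bounded_formula) : Prop :=
  match A with
  | f_eq s t => eval e s = eval e t
  | f_lt s t => eval e s < eval e t
  | f_mem t k => eval e t ∈ E k
  | f_not A => ~ sat e E A
  | f_and A B => sat e E A /\ sat e E B
  | f_or A B => sat e E A \/ sat e E B
  | f_imp A B => sat e E A -> sat e E B
  | f_ball t A => forall x, x < eval e t -> sat (env_cons x e) E A
  | f_bex t A => exists x, x < eval e t /\ sat (env_cons x e) E A
  end.

(** A Sigma^0_1 formula [exists m, A(m)] and a Pi^0_1 formula
    [forall m, A(m)] are both given by their bounded matrix [A]. *)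
Definition sat_Sigma1 {M : L2_structure} (e : nat -> num M) (E : nat -> set M)
    (A : bounded_formula) : Prop := exists m, sat (env_cons m e) E A.

Definition sat_Pi1 {M : L2_structure} (e : nat -> num M) (E : nat -> set M)
    (A : bounded_formula) : Prop := forall m, sat (env_cons m e) E A.

Record RCA0 (M : L2_structure) : Prop := {
  succ_neq_zero : forall n : num M, n + 1 <> 0;
  succ_inj : forall m n : num M, m + 1 = n + 1 -> m = n;
  add_zero : forall m : num M, m + 0 = m;
  add_succ : forall m n : num M, m + (n + 1) = (m + n) + 1;
  mul_zero : forall m : num M, m * 0 = 0;
  mul_succ : forall m n : num M, m * (n + 1) = m * n + m;
  not_lt_zero : forall m : num M, ~ m < 0;
  lt_succ : forall m n : num M, m < n + 1 <-> (m < n \/ m = n);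
  Sigma1_induction :
    forall (A : bounded_formula) (e : nat -> num M) (E : nat -> set M),
      sat_Sigma1 (env_cons 0 e) E A ->
      (forall n, sat_Sigma1 (env_cons n e) E A ->
                 sat_Sigma1 (env_cons (n + 1) e) E A) ->
      forall n, sat_Sigma1 (env_cons n e) E A;
  Delta1_comprehension :
    forall (A B : bounded_formula) (e : nat -> num M) (E : nat -> set M),
      (forall n, sat_Sigma1 (env_cons n e) E A <-> sat_Pi1 (env_cons n e) E B) ->
      exists X : set M, forall n, n ∈ X <-> sat_Sigma1 (env_cons n e) E A
}.

(** * Pairs, finite sequences and Weak König's Lemma *)

Section Coding.

Context {M : L2_structure}.
Implicit Types (c i j k l m n s t x y z : num M) (A B : num M -> Prop).
Implicit Types (T f : set M).

Definition pair i j : num M := (i + j) * (i + j) + i.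

Definition divides i j : Prop := exists q, j = i * q.

(** Simpson's coding: the finite set of those [i < k] for which [m (i + 1) + 1]
    divides [n] is represented by [(k, (m, n))]; its code is its least
    representative, so that each finite set has exactly one code. *)
Definition represents_set c : Prop := exists k m n, c = pair k (pair m n).

Definition fin_mem i c : Prop :=
  exists k m n, c = pair k (pair m n) /\ i < k /\ divides (m * (i + 1) + 1) n.

Definition fin_set_code c : Prop :=
  represents_set c /\
  forall d, d < c -> represents_set d -> ~ (forall i, fin_mem i d <-> fin_mem i c).

(** A finite sequence is the code of its graph. *)
Definition seq_entry s i j : Prop := fin_mem (pair i j) s.

Definition seq_length s l : Prop :=
  forall i, i < l <-> exists j, seq_entry s i j.

Definition fin_seq s : Prop :=
  fin_set_code s /\
  (forall z, fin_mem z s -> exists i j, z = pair i j) /\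
  (forall i j k, seq_entry s i j -> seq_entry s i k -> j = k) /\
  (exists l, seq_length s l).

Definition binary_seq s : Prop :=
  fin_seq s /\ forall i j, seq_entry s i j -> j = 0 \/ j = 1.

Definition initial_segment s t : Prop :=
  forall i j, seq_entry s i j -> seq_entry t i j.

Definition binary_tree T : Prop :=
  (forall s, s ∈ T -> binary_seq s) /\
  (forall s t, t ∈ T -> fin_seq s -> initial_segment s t -> s ∈ T).

Definition infinite T : Prop := ~ exists k, forall x, x ∈ T -> x < k.

(** Functions are sets of pairs; [(x, y) ∈ f] is written [maps_to f x y]. *)
Definition sub_prod A B f : Prop :=
  forall z, z ∈ f -> exists x y, A x /\ B y /\ z = pair x y.

Definition maps_to f x y : Prop := pair x y ∈ f.

Definition is_function A B f : Prop :=
  sub_prod A B f /\ forall x, A x -> exists! y, maps_to f x y.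

Definition infinite_path f T : Prop :=
  is_function (fun _ => True) (fun y => y = 0 \/ y = 1) f /\
  forall l, exists s, s ∈ T /\ fin_seq s /\ seq_length s l /\
    forall i j, i < l -> (seq_entry s i j <-> maps_to f i j).

End Coding.

Definition weak_Konig_lemma (M : L2_structure) : Prop :=
  forall T : set M, binary_tree T -> infinite T -> exists f, infinite_path f T.

Definition WKL0 (M : L2_structure) : Prop := RCA0 M /\ weak_Konig_lemma M.

(** * Interval orders *)

Section Orders.

Context {M : L2_structure}.
Implicit Types (p q x y z : num M) (P L R F f : set M).

Definition rel_le R p q : Prop := pair p q ∈ R.

Definition rel_lt R p q : Prop := rel_le R p q /\ p <> q.

Definition partial_order P leP : Prop :=
  sub_prod (mem P) (mem P) leP /\
  (forall p, p ∈ P -> rel_le leP p p) /\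
  (forall p q r, rel_le leP p q -> rel_le leP q r -> rel_le leP p r) /\
  (forall p q, rel_le leP p q -> rel_le leP q p -> p = q).

Definition linear_order L leL : Prop :=
  partial_order L leL /\
  forall x y, x ∈ L -> y ∈ L -> rel_le leL x y \/ rel_le leL y x.

Definition no_2_plus_2 leP : Prop :=
  forall p0 q0 p1 q1, rel_lt leP p0 q0 -> rel_lt leP p1 q1 ->
    rel_le leP p0 q1 \/ rel_le leP p1 q0.

Definition no_3_plus_1 P leP : Prop :=
  forall p0 p1 p2 q, q ∈ P -> rel_lt leP p0 p1 -> rel_lt leP p1 p2 ->
    rel_le leP p0 q \/ rel_le leP q p2.

Definition fiber F p x : Prop := pair p x ∈ F.

Definition convex L leL (A : num M -> Prop) : Prop :=
  forall x y z, A x -> A z -> y ∈ L -> rel_le leL x y -> rel_le leL y z -> A y.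

Definition cond_i1 P L leL F : Prop :=
  forall p, p ∈ P -> (exists x, fiber F p x) /\ convex L leL (fiber F p).

Definition cond_i2 P leP leL F : Prop :=
  forall p q, p ∈ P -> q ∈ P ->
    (rel_lt leP p q <->
     forall x y, fiber F p x -> fiber F q y -> rel_lt leL x y).

Definition cond_i3 P F : Prop :=
  forall p q, p ∈ P -> q ∈ P -> p <> q ->
    ~ (forall x, fiber F p x <-> fiber F q x).

Definition cond_i4 P F : Prop :=
  forall p q, p ∈ P -> q ∈ P ->
    (forall x, fiber F p x -> fiber F q x) ->
    forall x, fiber F p x <-> fiber F q x.

Definition proper_interval_order P leP : Prop :=
  exists L leL F, linear_order L leL /\ sub_prod (mem P) (mem L) F /\
    cond_i1 P L leL F /\ cond_i2 P leP leL F /\ cond_i4 P F.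

Definition proper_1_1_interval_order P leP : Prop :=
  exists L leL F, linear_order L leL /\ sub_prod (mem P) (mem L) F /\
    cond_i1 P L leL F /\ cond_i2 P leP leL F /\ cond_i3 P F /\ cond_i4 P F.

Definition cond_c1 P leL f0 f1 : Prop :=
  forall p x y, p ∈ P -> maps_to f0 p x -> maps_to f1 p y -> rel_le leL x y.

Definition cond_c2 P leP leL f0 f1 : Prop :=
  forall p q x y, p ∈ P -> q ∈ P -> maps_to f1 p x -> maps_to f0 q y ->
    (rel_lt leP p q <-> rel_lt leL x y).

Definition cond_c5 P leL f0 f1 : Prop :=
  forall p q x0 y0 x1 y1, p ∈ P -> q ∈ P ->
    maps_to f0 p x0 -> maps_to f0 q y0 ->
    maps_to f1 p x1 -> maps_to f1 q y1 ->
    (rel_lt leL x0 y0 <-> rel_lt leL x1 y1).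

Definition closed_interval_order P leP : Prop :=
  exists L leL f0 f1, linear_order L leL /\
    is_function (mem P) (mem L) f0 /\ is_function (mem P) (mem L) f1 /\
    cond_c1 P leL f0 f1 /\ cond_c2 P leP leL f0 f1.

Definition proper_closed_interval_order P leP : Prop :=
  exists L leL f0 f1, linear_order L leL /\
    is_function (mem P) (mem L) f0 /\ is_function (mem P) (mem L) f1 /\
    cond_c1 P leL f0 f1 /\ cond_c2 P leP leL f0 f1 /\ cond_c5 P leL f0 f1.

End Orders.

(* Main.v *)
(** Call a linear order on [P] compatible if [p <_P q] and [q] before [r] imply
    [p <_P r], and [p] before [q] and [q <_P r] imply [p <_P r]. Over RCA0, [P] has a
    compatible order iff it is a proper closed interval order iff it is a proper 1-1
    interval order: both kinds of representation arrange the intervals from left to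
    right, and conversely the endpoints [p_0], [p_1] can be ordered by the compatible
    order among the left and among the right endpoints, with [p_1] before [q_0] iff
    [p <_P q].

    If [P] contains neither 2+2 nor 3+1, order [p] before [q] when some element is below
    [q] and not below [p], or above [p] and not above [q], breaking ties by the order of
    the numbers. Restricting the witnesses to numbers below [l] makes this computable
    and still correct for [P] below [l], so these finite approximations form an infinite
    binary tree all of whose paths are compatible orders.

    Conversely, given disjoint Sigma^0_1 classes, take for every [n] two elements
    [a_n], [b_n] and blocks increasing with [n]; a witness for [n] in the first class
    adds an element above [a_n] only, which forces [a_n] before [b_n], and a witness for
    the second class adds an element below [a_n] only, which forces [b_n] before [a_n].
    This is a closed interval order, with [a_n] strictly inside [b_n], and a proper
    interval order, where the intervals of [a_n] and [b_n] are equal until a witness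
    adds new points to them. A compatible order of it separates the two classes, and
    separation proves Weak König's Lemma by deciding which of two extensions of a node
    dies first. *)

From Stdlib Require Import Arith Lia Classical Ring Setoid.
Require Import Defs.

(** * Definability *)

(* Everything happens inside an arbitrary, possibly nonstandard model. Every order, interval
   assignment and tree must come from Delta^0_1 comprehension and every induction must be on a
   Sigma^0_1 statement, so a calculus of definable predicates precedes the mathematics. In the
   forward direction the obstacle is that the unrestricted order is only Sigma^0_1: knowing that two
   elements are tied would require a search through all of P. In the converse direction the same
   order needs two representations, both computable without knowing whether a witness for n will
   ever appear. The closed one has fixed endpoints, with room for either kind of witness. In the
   proper one the intervals of a_n and b_n have to react to a witness, so they are given as sets of
   points, and the name of each added point contains the witness that adds it. Membership is then
   decided by inspecting that name. Two elements sharing one interval are permitted by (i4) and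
   excluded only by (i3). *)
Existing Class RCA0.

Definition twist {T : Type} (u v : nat -> T) (i : nat) : T :=
  if Nat.even i then u (Nat.div2 i) else v (Nat.div2 i).

Lemma twist_even {T} (u v : nat -> T) i : twist u v (2 * i) = u i.
Proof.
  unfold twist. now rewrite Nat.even_even, Nat.div2_double.
Qed.

Lemma twist_odd {T} (u v : nat -> T) i : twist u v (S (2 * i)) = v i.
Proof.
  unfold twist. rewrite Nat.div2_succ_double.
  replace (S (2 * i)) with (2 * i + 1)%nat by lia. now rewrite Nat.even_odd.
Qed.

Lemma twist_map {S T} (f : S -> T) (u v : nat -> S) i :
  f (twist u v i) = twist (fun a => f (u a)) (fun a => f (v a)) i.
Proof. unfold twist. now destruct (Nat.even i). Qed.

Lemma twist_ext {T} (u v u' v' : nat -> T) :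
  (forall a, u a = u' a) -> (forall a, v a = v' a) ->
  forall i, twist u v i = twist u' v' i.
Proof. intros Hu Hv i. unfold twist. now destruct (Nat.even i). Qed.

Fixpoint rename_term (f : nat -> nat) (t : term) : term :=
  match t with
  | t_var i => t_var (f i)
  | t_zero => t_zero
  | t_one => t_one
  | t_add s t => t_add (rename_term f s) (rename_term f t)
  | t_mul s t => t_mul (rename_term f s) (rename_term f t)
  end.

Definition rename_under (f : nat -> nat) (i : nat) : nat :=
  match i with O => O | S j => S (f j) end.

Fixpoint rename (f g : nat -> nat) (A : bounded_formula) : bounded_formula :=
  match A with
  | f_eq s t => f_eq (rename_term f s) (rename_term f t)
  | f_lt s t => f_lt (rename_term f s) (rename_term f t)
  | f_mem t k => f_mem (rename_term f t) (g k)
  | f_not A => f_not (rename f g A)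
  | f_and A B => f_and (rename f g A) (rename f g B)
  | f_or A B => f_or (rename f g A) (rename f g B)
  | f_imp A B => f_imp (rename f g A) (rename f g B)
  | f_ball t A => f_ball (rename_term f t) (rename (rename_under f) g A)
  | f_bex t A => f_bex (rename_term f t) (rename (rename_under f) g A)
  end.

Section Definability.

Context {M : L2_structure}.
Implicit Types (e par : nat -> num M) (E : nat -> set M).
Implicit Types (R Q : (nat -> num M) -> Prop) (s t : (nat -> num M) -> num M).

Lemma eval_rename f e e' (a : term) :
  (forall i, e' i = e (f i)) -> eval e (rename_term f a) = eval e' a.
Proof. intros H. induction a; simpl; congruence. Qed.

Lemma sat_rename (A : bounded_formula) : forall f g e e' E E',
  (forall i, e' i = e (f i)) -> (forall k, E' k = E (g k)) ->
  (sat e E (rename f g A) <-> sat e' E' A).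
Proof.
  assert (Hu : forall f e e' (x : num M), (forall i, e' i = e (f i)) ->
      forall i, env_cons x e' i = env_cons x e (rename_under f i)).
  { intros f e e' x H [|i]; simpl; auto. }
  induction A; intros ff gg e e' E E' He HE; simpl;
    rewrite ?(eval_rename ff e e') by assumption; try tauto.
  - now rewrite HE.
  - now rewrite (IHA ff gg e e' E E').
  - now rewrite (IHA1 ff gg e e' E E'), (IHA2 ff gg e e' E E').
  - now rewrite (IHA1 ff gg e e' E E'), (IHA2 ff gg e e' E E').
  - now rewrite (IHA1 ff gg e e' E E'), (IHA2 ff gg e e' E E').
  - split; intros H x Hx; specialize (H x Hx); revert H;
      apply (IHA (rename_under ff) gg); auto.
  - split; intros (x & Hx & H); exists x; (split; [exact Hx|]); revert H;
      apply (IHA (rename_under ff) gg); auto.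
Qed.

(** Predicates are taken on environments, the free variables being [e 0],
    [e 1], ..., and arbitrary elements of [M] may occur as parameters.
    Variables are interleaved with the parameters, so that the parameters of
    two formulas can be merged by another interleaving. *)
Definition term_def t : Prop :=
  exists a par, forall e, eval (twist e par) a = t e.

Definition Delta0 R : Prop :=
  exists A par E, forall e, sat (twist e par) E A <-> R e.

Lemma Delta0_ext R Q : (forall e, R e <-> Q e) -> Delta0 R -> Delta0 Q.
Proof.
  intros H (A & par & E & HA). exists A, par, E. intros e. now rewrite HA.
Qed.

Definition left_rename : nat -> nat :=
  twist (fun a => 2 * a)%nat (fun a => S (2 * (2 * a))).

Definition right_rename : nat -> nat :=
  twist (fun a => 2 * a)%nat (fun a => S (2 * (S (2 * a)))).

Lemma twist_left e par par' i :
  twist e par i = twist e (twist par par') (left_rename i).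
Proof.
  unfold left_rename. rewrite (twist_map (twist e _)).
  apply twist_ext; intros a; now rewrite ?twist_odd, ?twist_even.
Qed.

Lemma twist_right e par par' i :
  twist e par' i = twist e (twist par par') (right_rename i).
Proof.
  unfold right_rename. rewrite (twist_map (twist e _)).
  apply twist_ext; intros a; now rewrite ?twist_odd, ?twist_even.
Qed.

Lemma term_merge s t : term_def s -> term_def t ->
  exists a b par, forall e,
    eval (twist e par) a = s e /\ eval (twist e par) b = t e.
Proof.
  intros (a & p & Ha) (b & q & Hb).
  exists (rename_term left_rename a), (rename_term right_rename b), (twist p q).
  intros e. rewrite <- Ha, <- Hb. split; apply eval_rename; intros i.
  - apply twist_left.
  - apply twist_right.
Qed.

Lemma Delta0_merge R Q : Delta0 R -> Delta0 Q ->
  exists A B par E, forall e,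
    (sat (twist e par) E A <-> R e) /\ (sat (twist e par) E B <-> Q e).
Proof.
  intros (A & p & E & HA) (B & q & F & HB).
  exists (rename left_rename (fun k => 2 * k)%nat A),
    (rename right_rename (fun k => S (2 * k)) B), (twist p q), (twist E F).
  intros e. rewrite <- HA, <- HB. split; apply sat_rename; intros i.
  - apply twist_left.
  - now rewrite twist_even.
  - apply twist_right.
  - now rewrite twist_odd.
Qed.

Lemma term_Delta0_merge t R : term_def t -> Delta0 R ->
  exists a B par E, forall e,
    eval (twist e par) a = t e /\ (sat (twist e par) E B <-> R e).
Proof.
  intros (a & p & Ha) (B & q & F & HB).
  exists (rename_term left_rename a), (rename right_rename (fun k => k) B),
    (twist p q), F.
  intros e. rewrite <- Ha, <- HB. split.
  - apply eval_rename. intros i. apply twist_left.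
  - apply sat_rename; intros i; [apply twist_right | reflexivity].
Qed.

Lemma term_var i : term_def (fun e => e i).
Proof. exists (t_var (2 * i)), (fun _ => 0). intros e. apply twist_even. Qed.

Lemma term_const (c : num M) : term_def (fun _ => c).
Proof. exists (t_var 1), (fun _ => c). reflexivity. Qed.

Lemma term_add s t : term_def s -> term_def t -> term_def (fun e => s e + t e).
Proof.
  intros Hs Ht. destruct (term_merge s t Hs Ht) as (a & b & par & H).
  exists (t_add a b), par. intros e. simpl. destruct (H e). congruence.
Qed.

Lemma term_mul s t : term_def s -> term_def t -> term_def (fun e => s e * t e).
Proof.
  intros Hs Ht. destruct (term_merge s t Hs Ht) as (a & b & par & H).
  exists (t_mul a b), par. intros e. simpl. destruct (H e). congruence.
Qed.

Lemma term_shift t : term_def t -> term_def (fun e => t (fun i => e (S i))).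
Proof.
  intros (a & par & H).
  exists (rename_term (twist (fun a => 2 * S a)%nat (fun a => S (2 * a))) a), par.
  intros e. rewrite <- H. apply eval_rename. intros i.
  rewrite (twist_map (twist e _)). apply twist_ext; intros b.
  - now rewrite twist_even.
  - now rewrite twist_odd.
Qed.

Lemma Delta0_eq s t : term_def s -> term_def t -> Delta0 (fun e => s e = t e).
Proof.
  intros Hs Ht. destruct (term_merge s t Hs Ht) as (a & b & par & H).
  destruct (set_inhabited M) as [X].
  exists (f_eq a b), par, (fun _ => X). intros e. simpl.
  destruct (H e) as [-> ->]. tauto.
Qed.

Lemma Delta0_lt s t : term_def s -> term_def t -> Delta0 (fun e => s e < t e).
Proof.
  intros Hs Ht. destruct (term_merge s t Hs Ht) as (a & b & par & H).
  destruct (set_inhabited M) as [X].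
  exists (f_lt a b), par, (fun _ => X). intros e. simpl.
  destruct (H e) as [-> ->]. tauto.
Qed.

Lemma Delta0_mem t (X : set M) : term_def t -> Delta0 (fun e => t e ∈ X).
Proof.
  intros (a & par & Ha). exists (f_mem a 0), par, (fun _ => X).
  intros e. simpl. now rewrite Ha.
Qed.

Lemma Delta0_not R : Delta0 R -> Delta0 (fun e => ~ R e).
Proof.
  intros (A & par & E & H). exists (f_not A), par, E. intros e. simpl.
  now rewrite H.
Qed.

Lemma Delta0_and R Q : Delta0 R -> Delta0 Q -> Delta0 (fun e => R e /\ Q e).
Proof.
  intros HR HQ. destruct (Delta0_merge R Q HR HQ) as (A & B & par & E & H).
  exists (f_and A B), par, E. intros e. simpl. destruct (H e). tauto.
Qed.

Lemma Delta0_or R Q : Delta0 R -> Delta0 Q -> Delta0 (fun e => R e \/ Q e).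
Proof.
  intros HR HQ. destruct (Delta0_merge R Q HR HQ) as (A & B & par & E & H).
  exists (f_or A B), par, E. intros e. simpl. destruct (H e). tauto.
Qed.

Lemma Delta0_imp R Q : Delta0 R -> Delta0 Q -> Delta0 (fun e => R e -> Q e).
Proof.
  intros HR HQ. destruct (Delta0_merge R Q HR HQ) as (A & B & par & E & H).
  exists (f_imp A B), par, E. intros e. simpl. destruct (H e). tauto.
Qed.

(** A bound variable is pushed in front of the interleaved environment and so flips the parity of
    all other indices: the variable with index [S b] moves from position [2 * S b] to [S (2 * b)],
    and parameter [a] from [S (2 * a)] to the next even position. *)
Definition bind_rename (i : nat) : nat :=
  twist (fun a => match a with O => O | S b => S (2 * b) end)
    (fun a => S (S (2 * a))) i.

Lemma twist_bind e par (x : num M) i :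
  twist (env_cons x e) par i = env_cons x (twist e par) (bind_rename i).
Proof.
  unfold bind_rename. rewrite (twist_map (env_cons x _)).
  apply twist_ext; intros [|a]; cbn [env_cons];
    rewrite ?twist_odd, ?twist_even; try reflexivity.
  all: symmetry; apply (twist_odd e par).
Qed.

Lemma Delta0_bind (R : (nat -> num M) -> num M -> Prop) t :
  term_def t -> Delta0 (fun e => R (fun i => e (S i)) (e O)) ->
  exists a B par E, forall e, eval (twist e par) a = t e /\
    forall x, sat (env_cons x (twist e par)) E B <-> R e x.
Proof.
  intros Ht HR. destruct (term_Delta0_merge t _ Ht HR) as (a & B & par & E & H).
  exists a, (rename bind_rename (fun k => k) B), par, E. intros e. split.
  - apply H.
  - intros x. rewrite (sat_rename B bind_rename (fun k => k) _
      (twist (env_cons x e) par) E E); [apply (H (env_cons x e))| |reflexivity].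
    intros i. apply twist_bind.
Qed.

Lemma Delta0_ball (R : (nat -> num M) -> num M -> Prop) t :
  term_def t -> Delta0 (fun e => R (fun i => e (S i)) (e O)) ->
  Delta0 (fun e => forall x, x < t e -> R e x).
Proof.
  intros Ht HR. destruct (Delta0_bind R t Ht HR) as (a & B & par & E & H).
  exists (f_ball a B), par, E. intros e. simpl. destruct (H e) as [-> H'].
  now setoid_rewrite H'.
Qed.

Lemma Delta0_bex (R : (nat -> num M) -> num M -> Prop) t :
  term_def t -> Delta0 (fun e => R (fun i => e (S i)) (e O)) ->
  Delta0 (fun e => exists x, x < t e /\ R e x).
Proof.
  intros Ht HR. destruct (Delta0_bind R t Ht HR) as (a & B & par & E & H).
  exists (f_bex a B), par, E. intros e. simpl. destruct (H e) as [-> H'].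
  now setoid_rewrite H'.
Qed.

(** Each variable becomes another variable or a fixed element of the model. The fixed elements are
    stored as new parameters at even parameter positions, the old parameters move to the odd
    ones. *)
Lemma Delta0_subst R (g : nat -> nat + num M) (h : (nat -> num M) -> nat -> num M) :
  (forall e i, h e i = match g i with inl j => e j | inr c => c end) ->
  Delta0 R -> Delta0 (fun e => R (h e)).
Proof.
  intros Hh (A & par & E & H).
  pose (k := fun a => match g a with inl j => (2 * j)%nat | inr _ => S (2 * (2 * a)) end).
  exists (rename (twist k (fun a => S (2 * (S (2 * a))))) (fun k => k) A),
    (twist (fun i => match g i with inl _ => 0 | inr c => c end) par), E.
  intros e. rewrite <- H. apply sat_rename; [|reflexivity].
  intros i. rewrite (twist_map (twist e _)). apply twist_ext; intros a.
  - rewrite Hh. unfold k.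
    destruct (g a) eqn:Ea; rewrite ?twist_even, ?twist_odd, ?twist_even; [reflexivity|].
    now rewrite Ea.
  - now rewrite !twist_odd.
Qed.

(** Excluded middle of the metatheory replaces [C] by a true or a false equation. This makes
    comparisons of standard numbers, such as the tags used later, admissible in formulas. *)
Lemma Delta0_const (C : Prop) : Delta0 (fun _ => C).
Proof.
  destruct (classic C) as [H|H].
  - apply (Delta0_ext (fun _ => (0 : num M) = 0)); [tauto|].
    apply (Delta0_eq (fun _ => 0) (fun _ => 0)); apply term_const.
  - apply (Delta0_ext (fun _ => ~ (0 : num M) = 0)); [tauto|].
    apply Delta0_not. apply (Delta0_eq (fun _ => 0) (fun _ => 0)); apply term_const.
Qed.

End Definability.

(** * Arithmetic *)

Ltac definable_term :=
  first [ apply term_var | apply term_const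
        | apply term_add; definable_term | apply term_mul; definable_term ].

Ltac definable_Delta0 :=
  cbv beta;
  first [ apply Delta0_const
        | apply Delta0_eq; definable_term
        | apply Delta0_lt; definable_term
        | apply Delta0_mem; definable_term
        | apply Delta0_ball; [definable_term | definable_Delta0]
        | apply Delta0_bex; [definable_term | definable_Delta0]
        | apply Delta0_not; definable_Delta0
        | apply Delta0_and; definable_Delta0
        | apply Delta0_or; definable_Delta0
        | apply Delta0_imp; definable_Delta0 ].

Section Induction.

Context {M : L2_structure} {HM : RCA0 M}.
Implicit Types (x y z a b c d i j k m n : num M).

(** The axioms of [RCA0] use plain environments in which the parameters follow the number variables.
    Filling the variables from index 2 on with [par] turns the interleaved environment into a
    renaming of a plain one. Two predicates are treated together because comprehension needs both
    formulas over one environment. *)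
Lemma induction_matrix (Q R : (nat -> num M) -> Prop) : Delta0 Q -> Delta0 R ->
  exists A B e0 E, forall n,
    (sat_Sigma1 (env_cons n e0) E A <-> exists m, Q (env_cons m (env_cons n e0))) /\
    (sat_Sigma1 (env_cons n e0) E B <-> exists m, R (env_cons m (env_cons n e0))).
Proof.
  intros HQ HR. destruct (Delta0_merge Q R HQ HR) as (A & B & par & E & H).
  pose (f := twist (fun a : nat => a) (fun a : nat => S (S a))).
  assert (Hf : forall m n (i : nat), twist (env_cons m (env_cons n par)) par i =
      env_cons m (env_cons n par) (f i)).
  { intros m n i. unfold f. now rewrite (twist_map (env_cons m (env_cons n par))). }
  exists (rename f (fun k : nat => k) A), (rename f (fun k : nat => k) B), par, E.
  intros n. split; unfold sat_Sigma1.
  all: split; intros [m Hm]; exists m; revert Hm.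
  all: erewrite sat_rename; [apply (H (env_cons m (env_cons n par)))|apply Hf|reflexivity].
Qed.

Lemma Sigma1_matrix_induction (R : num M -> num M -> Prop) :
  Delta0 (fun e => R (e O) (e 1%nat)) ->
  (exists m, R m 0) -> (forall n, (exists m, R m n) -> exists m, R m (n + 1)) ->
  forall n, exists m, R m n.
Proof.
  intros HR H0 HS n.
  destruct (induction_matrix _ _ HR HR) as (A & B & e0 & E & Hsat).
  assert (H : forall n, sat_Sigma1 (env_cons n e0) E A <-> exists m, R m n)
    by (intros k; apply Hsat). apply (H n), (Sigma1_induction M HM).
  - now apply H.
  - intros k Hk. apply H, HS, H, Hk.
Qed.

Lemma Delta0_induction (R : num M -> Prop) : Delta0 (fun e => R (e O)) ->
  R 0 -> (forall n, R n -> R (n + 1)) -> forall n, R n.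
Proof.
  intros HR H0 HS n.
  destruct (Sigma1_matrix_induction (fun _ n => R n)) with (n := n) as [_ H]; auto.
  - apply (Delta0_subst _ (fun i : nat => inl (S i)) (fun e (i : nat) => e (S i))
      (fun _ _ => eq_refl) HR).
  - now exists 0.
  - intros k [_ Hk]. exists 0. auto.
Qed.

End Induction.

Ltac Delta0_induct n :=
  pattern n; revert n; apply Delta0_induction; [definable_Delta0|..].

Section Arithmetic.

Context {M : L2_structure} {HM : RCA0 M}.
Implicit Types (x y z a b c d i j k m n : num M).

Lemma zero_add n : 0 + n = n.
Proof.
  Delta0_induct n; [apply (add_zero M HM)|]. intros n IH.
  now rewrite (add_succ M HM), IH.
Qed.

Lemma succ_add m n : (m + 1) + n = (m + n) + 1.
Proof.
  Delta0_induct n; [now rewrite !(add_zero M HM)|]. intros n IH.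
  now rewrite !(add_succ M HM), IH.
Qed.

Lemma add_comm m n : m + n = n + m.
Proof.
  Delta0_induct n; [now rewrite zero_add, (add_zero M HM)|]. intros n IH.
  now rewrite succ_add, (add_succ M HM), IH.
Qed.

Lemma add_assoc m n k : m + (n + k) = (m + n) + k.
Proof.
  Delta0_induct k; [now rewrite !(add_zero M HM)|]. intros k IH.
  now rewrite !(add_succ M HM), IH.
Qed.

Lemma zero_mul n : 0 * n = 0.
Proof.
  Delta0_induct n; [apply (mul_zero M HM)|]. intros n IH.
  now rewrite (mul_succ M HM), IH, zero_add.
Qed.

Lemma succ_mul m n : (m + 1) * n = m * n + n.
Proof.
  Delta0_induct n; [now rewrite !(mul_zero M HM), zero_add|]. intros n IH.
  rewrite !(mul_succ M HM), IH, !(add_succ M HM). f_equal.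
  now rewrite <- !add_assoc, (add_comm n m).
Qed.

Lemma mul_comm m n : m * n = n * m.
Proof.
  Delta0_induct n; [now rewrite zero_mul, (mul_zero M HM)|]. intros n IH.
  now rewrite succ_mul, (mul_succ M HM), IH.
Qed.

Lemma add_mul m n k : (m + n) * k = m * k + n * k.
Proof.
  Delta0_induct k; [now rewrite !(mul_zero M HM), zero_add|]. intros k IH.
  rewrite !(mul_succ M HM), IH, <- !add_assoc. f_equal.
  now rewrite !add_assoc, (add_comm m (n * k)).
Qed.

Lemma mul_assoc m n k : m * (n * k) = (m * n) * k.
Proof.
  rewrite (mul_comm m (n * k)).
  Delta0_induct n; [now rewrite !zero_mul, (mul_zero M HM), zero_mul|]. intros n IH.
  rewrite succ_mul, add_mul, IH, (mul_succ M HM), add_mul.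
  now rewrite (mul_comm k m).
Qed.

Lemma one_mul n : 1 * n = n.
Proof. rewrite <- (zero_add 1), succ_mul, zero_mul. apply zero_add. Qed.

Lemma num_semiring : semi_ring_theory 0 1 add mul (@eq (num M)).
Proof.
  constructor; intros.
  - apply zero_add.
  - apply add_comm.
  - apply add_assoc.
  - apply one_mul.
  - apply zero_mul.
  - apply mul_comm.
  - apply mul_assoc.
  - apply add_mul.
Qed.

Add Ring num_ring : num_semiring.

Lemma add_cancel_r m n k : m + k = n + k -> m = n.
Proof.
  Delta0_induct k; [now rewrite !(add_zero M HM)|]. intros k IH.
  rewrite !(add_succ M HM). intros H. now apply IH, (succ_inj M HM).
Qed.

Lemma add_cancel_l m n k : k + m = k + n -> m = n.
Proof. rewrite !(add_comm k). apply add_cancel_r. Qed.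

Lemma zero_or_succ n : n = 0 \/ exists m, n = m + 1.
Proof.
  (* The bound on the predecessor makes the induction statement a bounded formula. *)
  assert (H : n = 0 \/ exists m, m < n /\ n = m + 1).
  { Delta0_induct n; [now left|]. intros n _. right. exists n. split; [|reflexivity].
    apply (lt_succ M HM). now right. }
  destruct H as [H|(m & _ & H)]; [now left|right; now exists m].
Qed.

Lemma lt_add_succ x d : x < x + d + 1.
Proof.
  Delta0_induct d; [|intros d IH]; apply (lt_succ M HM).
  - right. ring.
  - left. replace (x + (d + 1)) with (x + d + 1) by ring. exact IH.
Qed.

Lemma lt_iff x y : x < y <-> exists d, y = x + d + 1.
Proof.
  split; [|intros [d ->]; apply lt_add_succ].
  (* The witness is pulled out of the implication, so that Sigma^0_1 induction applies with a
     bounded matrix. *)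
  intros H. cut (exists d, x < y -> y = x + d + 1).
  { intros [d Hd]. exists d. auto. }
  clear H. revert y. apply (Sigma1_matrix_induction (fun d y => x < y -> y = x + d + 1)).
  - definable_Delta0.
  - exists 0. intros H. now destruct (not_lt_zero M HM x).
  - intros y [d IH]. destruct (classic (x < y)) as [H|H].
    + exists (d + 1). intros _. rewrite (IH H) at 1. ring.
    + exists 0. intros H'. apply (lt_succ M HM) in H' as [H'| ->]; [contradiction|ring].
Qed.

Definition le x y : Prop := exists d, y = x + d.

Lemma lt_succ_le x y : x < y + 1 <-> le x y.
Proof.
  rewrite lt_iff. split; intros [d H]; exists d.
  - now apply (succ_inj M HM).
  - now rewrite H.
Qed.

Lemma add_eq_zero x y : x + y = 0 -> x = 0.
Proof.
  destruct (zero_or_succ x) as [-> | [z ->]]; [auto|]. intros H.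
  destruct (succ_neq_zero M HM (z + y)). rewrite <- H. ring.
Qed.

Lemma lt_irrefl x : ~ x < x.
Proof.
  rewrite lt_iff. intros [d H]. apply (succ_neq_zero M HM d).
  apply (add_cancel_l _ _ x). rewrite add_zero by assumption.
  rewrite H at 2. ring.
Qed.

Lemma lt_trans x y z : x < y -> y < z -> x < z.
Proof.
  rewrite !lt_iff. intros [d ->] [c ->]. exists (d + c + 1). ring.
Qed.

Lemma lt_le_trans x y z : x < y -> le y z -> x < z.
Proof. rewrite !lt_iff. intros [d ->] [c ->]. exists (d + c). ring. Qed.

Lemma le_lt_trans x y z : le x y -> y < z -> x < z.
Proof. rewrite !lt_iff. intros [d ->] [c ->]. exists (d + c). ring. Qed.

Lemma le_trans x y z : le x y -> le y z -> le x z.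
Proof. intros [d ->] [c ->]. exists (d + c). ring. Qed.

Lemma lt_le x y : x < y -> le x y.
Proof. rewrite lt_iff. intros [d ->]. exists (d + 1). ring. Qed.

Lemma le_refl x : le x x.
Proof. exists 0. ring. Qed.

Lemma le_add_r x y : le x (x + y).
Proof. now exists y. Qed.

Lemma le_add_l x y : le x (y + x).
Proof. exists y. ring. Qed.

Lemma zero_le x : le 0 x.
Proof. exists x. ring. Qed.

Lemma le_lt_or_eq x y : le x y -> x < y \/ x = y.
Proof. rewrite <- lt_succ_le. apply (lt_succ M HM). Qed.

Lemma lt_or_le x y : x < y \/ le y x.
Proof.
  rewrite <- lt_succ_le. Delta0_induct x.
  - destruct (zero_or_succ y) as [-> | [z ->]]; [right|left];
      apply lt_succ_le, zero_le.
  - intros x [H|H].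
    + rewrite lt_succ_le. rewrite lt_iff in H. destruct H as [d ->].
      destruct (zero_or_succ d) as [-> | [c ->]].
      * right. exists 0. ring.
      * left. apply lt_iff. exists c. ring.
    + right. apply (lt_trans _ _ _ H). apply lt_iff. exists 0. ring.
Qed.

Lemma lt_not_le x y : x < y -> le y x -> False.
Proof. intros H H'. exact (lt_irrefl x (lt_le_trans _ _ _ H H')). Qed.

Lemma trichotomy x y : x < y \/ x = y \/ y < x.
Proof.
  destruct (lt_or_le x y) as [H|H]; [auto|].
  destruct (le_lt_or_eq _ _ H); auto.
Qed.

Lemma lt_one_succ x : x < x + 1.
Proof. apply lt_iff. exists 0. ring. Qed.

Lemma succ_lt_succ x y : x + 1 < y + 1 <-> x < y.
Proof.
  rewrite !lt_iff. split; intros [d H]; exists d.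
  - apply (succ_inj M HM). rewrite H. ring.
  - rewrite H. ring.
Qed.

Lemma lt_zero_succ x : 0 < x + 1.
Proof. apply lt_iff. exists x. ring. Qed.

Lemma mul_le x y z w : le x y -> le z w -> le (x * z) (y * w).
Proof. intros [d ->] [c ->]. exists (x * c + d * z + d * c). ring. Qed.

Lemma add_le x y z w : le x y -> le z w -> le (x + z) (y + w).
Proof. intros [d ->] [c ->]. exists (d + c). ring. Qed.

Lemma mul_eq_zero x y : x * y = 0 -> x = 0 \/ y = 0.
Proof.
  destruct (zero_or_succ x) as [-> | [z ->]]; [auto|].
  destruct (zero_or_succ y) as [-> | [w ->]]; [auto|]. intros H.
  destruct (succ_neq_zero M HM (z * w + z + w)). rewrite <- H. ring.
Qed.

Lemma pos_neq_zero x : 0 < x <-> x <> 0.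
Proof.
  split.
  - intros H ->. exact (lt_irrefl _ H).
  - intros H. destruct (zero_or_succ x) as [-> | [z ->]]; [easy|]. apply lt_zero_succ.
Qed.

Lemma mul_pos x y : 0 < x -> 0 < y -> 0 < x * y.
Proof.
  rewrite !pos_neq_zero. intros Hx Hy H. now destruct (mul_eq_zero _ _ H).
Qed.

(** The squares of [i + j] and of its successor differ by 2(i + j) + 1, more than the summand [i]
    can make up. *)
Lemma pair_lt i j k l : i + j < k + l -> pair i j < pair k l.
Proof.
  unfold pair. rewrite !lt_iff. intros [d ->].
  exists ((i + j) * (d + 1) + (i + j) * d + j + d * d + d + d + k). ring.
Qed.

Lemma pair_inj i j k l : pair i j = pair k l -> i = k /\ j = l.
Proof.
  intros H. destruct (trichotomy (i + j) (k + l)) as [L|[L|L]].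
  - apply pair_lt in L. rewrite H in L. now apply lt_irrefl in L.
  - unfold pair in H. rewrite L in H. apply add_cancel_l in H. subst k.
    now apply add_cancel_l in L.
  - apply pair_lt in L. rewrite H in L. now apply lt_irrefl in L.
Qed.

Lemma le_pair_l i j : le i (pair i j).
Proof. exists ((i + j) * (i + j)). unfold pair. ring. Qed.

Lemma le_pair_r i j : le j (pair i j).
Proof.
  unfold pair. destruct (zero_or_succ j) as [-> | [c ->]].
  - apply zero_le.
  - exists (i * i + (1 + 1) * i * (c + 1) + c * c + c + i). ring.
Qed.

Lemma pair_le i j k l : le i k -> le j l -> le (pair i j) (pair k l).
Proof. intros H H'. unfold pair. auto using add_le, mul_le. Qed.

End Arithmetic.

(** * Sigma1 and Delta1 predicates *)

Section Complexity.

Context {M : L2_structure} {HM : RCA0 M}.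
Implicit Types (e : nat -> num M) (R Q : (nat -> num M) -> Prop).
Implicit Types (s t : (nat -> num M) -> num M).

Definition Sigma1 R : Prop :=
  exists Q, Delta0 Q /\ forall e, R e <-> exists m, Q (env_cons m e).

Definition Delta1 R : Prop := Sigma1 R /\ Sigma1 (fun e => ~ R e).

Lemma Sigma1_ext R Q : (forall e, R e <-> Q e) -> Sigma1 R -> Sigma1 Q.
Proof.
  intros H (A & HA & HR). exists A. split; [exact HA|].
  intros e. now rewrite <- H.
Qed.

Lemma Delta1_ext R Q : (forall e, R e <-> Q e) -> Delta1 R -> Delta1 Q.
Proof.
  intros H [H1 H2]. split; [now apply (Sigma1_ext R)|].
  apply (Sigma1_ext (fun e => ~ R e)); [|exact H2]. intros e. now rewrite H.
Qed.

Lemma Delta0_Sigma1 R : Delta0 R -> Sigma1 R.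
Proof.
  intros H. exists (fun e => R (fun i => e (S i))). split.
  - exact (Delta0_subst R (fun i => inl (S i)) (fun e i => e (S i))
      (fun _ _ => eq_refl) H).
  - intros e. split; [exists 0; assumption | now intros [m Hm]].
Qed.

Lemma Delta0_Delta1 R : Delta0 R -> Delta1 R.
Proof. intros H. split; apply Delta0_Sigma1; [|apply Delta0_not]; exact H. Qed.

Lemma Delta1_Sigma1 R : Delta1 R -> Sigma1 R.
Proof. now intros []. Qed.

Lemma Delta0_skip R : Delta0 R ->
  Delta0 (fun e => R (env_cons (e 0%nat) (fun i => e (S (S i))))).
Proof.
  apply (Delta0_subst R (fun i => inl match i with O => O | S j => S (S j) end)
    (fun e => env_cons (e 0%nat) (fun i => e (S (S i))))).
  now intros e [|i].
Qed.

Lemma Delta0_skip2 R : Delta0 R ->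
  Delta0 (fun e => R (env_cons (e 0%nat) (env_cons (e 1%nat) (fun i => e (S (S (S i))))))).
Proof.
  apply (Delta0_subst R
    (fun i => inl match i with O => O | S O => 1%nat | S (S j) => S (S (S j)) end)
    (fun e => env_cons (e 0%nat) (env_cons (e 1%nat) (fun i => e (S (S (S i))))))).
  now intros e [|[|i]].
Qed.

(** A number above both witnesses serves as the common witness, so no projections of a pair are
    needed. *)
Lemma Sigma1_and R Q : Sigma1 R -> Sigma1 Q -> Sigma1 (fun e => R e /\ Q e).
Proof.
  intros (A & HA & HR) (B & HB & HQ).
  exists (fun e => (exists x, x < e 0%nat /\ A (env_cons x (fun i => e (S i)))) /\
    (exists x, x < e 0%nat /\ B (env_cons x (fun i => e (S i))))).
  split.
  - apply Delta0_and.
    + apply (Delta0_bex (fun e x => A (env_cons x (fun i => e (S i)))));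
        [apply term_var | now apply Delta0_skip].
    + apply (Delta0_bex (fun e x => B (env_cons x (fun i => e (S i)))));
        [apply term_var | now apply Delta0_skip].
  - intros e. rewrite HR, HQ. split.
    + intros [[x Hx] [y Hy]]. exists (x + y + 1). split.
      * exists x. split; [apply lt_succ_le, le_add_r | exact Hx].
      * exists y. split; [apply lt_succ_le, le_add_l | exact Hy].
    + intros (m & (x & _ & Hx) & (y & _ & Hy)). split; [now exists x | now exists y].
Qed.

Lemma Sigma1_or R Q : Sigma1 R -> Sigma1 Q -> Sigma1 (fun e => R e \/ Q e).
Proof.
  intros (A & HA & HR) (B & HB & HQ).
  exists (fun e => A e \/ B e). split; [now apply Delta0_or|].
  intros e. rewrite HR, HQ. split.
  - intros [[x Hx] | [x Hx]]; exists x; auto.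
  - intros [x [Hx | Hx]]; [left | right]; now exists x.
Qed.

Lemma Sigma1_ex (R : (nat -> num M) -> num M -> Prop) :
  Sigma1 (fun e => R (fun i => e (S i)) (e 0%nat)) ->
  Sigma1 (fun e => exists x, R e x).
Proof.
  intros (A & HA & HR).
  exists (fun e => exists x, x < e 0%nat /\ exists m, m < e 0%nat /\
    A (env_cons m (env_cons x (fun i => e (S i))))).
  split.
  - apply (Delta0_bex (fun e x => exists m, m < e 0%nat /\
      A (env_cons m (env_cons x (fun i => e (S i)))))); [apply term_var|].
    apply (Delta0_bex (fun e m => A (env_cons m (env_cons (e 0%nat)
      (fun i => e (S (S i))))))); [apply term_var|].
    now apply Delta0_skip2.
  - intros e. split.
    + intros [x Hx]. apply (HR (env_cons x e)) in Hx as [m Hm].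
      exists (x + m + 1), x. split; [apply lt_succ_le, le_add_r|].
      exists m. split; [apply lt_succ_le, le_add_l | exact Hm].
    + intros (b & x & _ & m & _ & H). exists x. apply (HR (env_cons x e)). now exists m.
Qed.

(** Induction on [n] collects a bound for all [x < n], enlarging it by the witness for [n]. The
    guard [x < k] keeps the statement true beyond [k], where no witnesses are promised. *)
Lemma collection (R : num M -> num M -> Prop) k :
  Delta0 (fun e => R (e 0%nat) (e 1%nat)) ->
  (forall x, x < k -> exists m, R m x) ->
  exists b, forall x, x < k -> exists m, m < b /\ R m x.
Proof.
  intros HR H.
  destruct (Sigma1_matrix_induction
    (fun b n => forall x, x < n -> x < k -> exists m, m < b /\ R m x)) with (n := k)
    as [b Hb].
  - apply (Delta0_ball (fun e x => x < k -> exists m, m < e 0%nat /\ R m x));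
      [apply term_var|].
    apply Delta0_imp; [definable_Delta0|].
    apply (Delta0_bex (fun e m => R m (e 0%nat))); [apply term_var | exact HR].
  - exists 0. intros x Hx. now destruct (not_lt_zero M HM x).
  - intros n [b IH]. destruct (classic (n < k)) as [Hn|Hn].
    + destruct (H n Hn) as [m Hm]. exists (b + m + 1). intros x Hx Hk.
      apply (lt_succ M HM) in Hx as [Hx | ->].
      * destruct (IH x Hx Hk) as (m' & Hb & Hm'). exists m'. split; [|exact Hm'].
        apply (lt_trans _ _ _ Hb), lt_succ_le, le_add_r.
      * exists m. split; [apply lt_succ_le, le_add_l | exact Hm].
    + exists b. intros x Hx Hk. apply (lt_succ M HM) in Hx as [Hx | ->]; auto.
      contradiction.
  - exists b. auto.
Qed.

(** Collection bounds the witnesses for all [x] at once, which moves the unbounded quantifier to the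
    front. *)
Lemma Sigma1_ball (R : (nat -> num M) -> num M -> Prop) t :
  term_def t -> Sigma1 (fun e => R (fun i => e (S i)) (e 0%nat)) ->
  Sigma1 (fun e => forall x, x < t e -> R e x).
Proof.
  intros Ht (A & HA & HR).
  exists (fun e => forall x, x < t (fun i => e (S i)) -> exists m, m < e 0%nat /\
    A (env_cons m (env_cons x (fun i => e (S i))))).
  split.
  - apply (Delta0_ball (fun e x => exists m, m < e 0%nat /\
      A (env_cons m (env_cons x (fun i => e (S i))))) (fun e => t (fun i => e (S i))));
      [now apply term_shift|].
    apply (Delta0_bex (fun e m => A (env_cons m (env_cons (e 0%nat)
      (fun i => e (S (S i))))))); [apply term_var|].
    now apply Delta0_skip2.
  - intros e. split.
    + intros H. apply (collection (fun m x => A (env_cons m (env_cons x e))) (t e)).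
      * apply (Delta0_subst A
          (fun i => match i with O => inl O | S O => inl 1%nat | S (S j) => inr (e j) end)
          (fun e' => env_cons (e' 0%nat) (env_cons (e' 1%nat) e))); [|exact HA].
        now intros e' [|[|i]].
      * intros x Hx. apply (HR (env_cons x e)), H, Hx.
    + intros [b H] x Hx. apply (HR (env_cons x e)).
      destruct (H x Hx) as (m & _ & Hm). now exists m.
Qed.

Lemma Sigma1_imp R Q : Delta1 R -> Sigma1 Q -> Sigma1 (fun e => R e -> Q e).
Proof.
  intros [_ HR] HQ. apply (Sigma1_ext (fun e => ~ R e \/ Q e)).
  - intros e. destruct (classic (R e)); tauto.
  - now apply Sigma1_or.
Qed.

Lemma Delta1_not R : Delta1 R -> Delta1 (fun e => ~ R e).
Proof.
  intros [H H']. split; [exact H'|]. apply (Sigma1_ext R); [|exact H].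
  intros e. split; [tauto | apply NNPP].
Qed.

Lemma Delta1_and R Q : Delta1 R -> Delta1 Q -> Delta1 (fun e => R e /\ Q e).
Proof.
  intros [H H'] [G G']. split; [now apply Sigma1_and|].
  apply (Sigma1_ext (fun e => ~ R e \/ ~ Q e)); [|now apply Sigma1_or].
  intros e. destruct (classic (R e)); tauto.
Qed.

Lemma Delta1_or R Q : Delta1 R -> Delta1 Q -> Delta1 (fun e => R e \/ Q e).
Proof.
  intros [H H'] [G G']. split; [now apply Sigma1_or|].
  apply (Sigma1_ext (fun e => ~ R e /\ ~ Q e)); [tauto | now apply Sigma1_and].
Qed.

Lemma Delta1_imp R Q : Delta1 R -> Delta1 Q -> Delta1 (fun e => R e -> Q e).
Proof.
  intros HR HQ. apply (Delta1_ext (fun e => ~ R e \/ Q e)).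
  - intros e. destruct (classic (R e)); tauto.
  - apply Delta1_or; [now apply Delta1_not | exact HQ].
Qed.

Lemma Delta1_iff R Q : Delta1 R -> Delta1 Q -> Delta1 (fun e => R e <-> Q e).
Proof. intros HR HQ. apply Delta1_and; now apply Delta1_imp. Qed.

Lemma Delta1_bex (R : (nat -> num M) -> num M -> Prop) t :
  term_def t -> Delta1 (fun e => R (fun i => e (S i)) (e 0%nat)) ->
  Delta1 (fun e => exists x, x < t e /\ R e x).
Proof.
  intros Ht [H H']. split.
  - apply (Sigma1_ex (fun e x => x < t e /\ R e x)).
    apply Sigma1_and; [|exact H].
    apply Delta0_Sigma1, Delta0_lt; [apply term_var | now apply term_shift].
  - apply (Sigma1_ext (fun e => forall x, x < t e -> ~ R e x)).
    + intros e. firstorder.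
    + now apply (Sigma1_ball (fun e x => ~ R e x)).
Qed.

Lemma Delta1_ball (R : (nat -> num M) -> num M -> Prop) t :
  term_def t -> Delta1 (fun e => R (fun i => e (S i)) (e 0%nat)) ->
  Delta1 (fun e => forall x, x < t e -> R e x).
Proof.
  intros Ht H. apply (Delta1_ext (fun e => ~ exists x, x < t e /\ ~ R e x)).
  - intros e. split; [|firstorder]. intros H' x Hx. apply NNPP. firstorder.
  - apply Delta1_not. apply (Delta1_bex (fun e x => ~ R e x)); [exact Ht|].
    now apply Delta1_not.
Qed.

Lemma Sigma1_var (P : num M -> Prop) k : Sigma1 (fun e => P (e 0%nat)) ->
  Sigma1 (fun e => P (e k)).
Proof.
  intros (A & HA & H).
  exists (fun e => A (env_cons (e 0%nat) (fun i => e (S k)))). split.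
  - apply (Delta0_subst A (fun i => inl match i with O => O | S _ => S k end)
      (fun e => env_cons (e 0%nat) (fun i => e (S k)))); [|exact HA]. now intros e [|i].
  - intros e. apply (H (fun _ => e k)).
Qed.

Lemma Delta1_var (P : num M -> Prop) k : Delta1 (fun e => P (e 0%nat)) ->
  Delta1 (fun e => P (e k)).
Proof.
  intros [H H']. split; [now apply Sigma1_var|].
  exact (Sigma1_var (fun x => ~ P x) k H').
Qed.

Lemma term_pair s t : term_def s -> term_def t -> term_def (fun e => pair (s e) (t e)).
Proof.
  intros Hs Ht. unfold pair. apply term_add; [apply term_mul|]; try apply term_add;
    assumption.
Qed.

(** Both components are at most the code of the pair, so the quantifiers can be bounded. *)
Lemma Delta1_ex_pair (R : (nat -> num M) -> num M -> num M -> Prop) t :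
  term_def t -> Delta1 (fun e => R (fun i => e (S (S i))) (e 1%nat) (e 0%nat)) ->
  Delta1 (fun e => exists i j, t e = pair i j /\ R e i j).
Proof.
  intros Ht HR. apply (Delta1_ext (fun e => exists i, i < t e + 1 /\
    exists j, j < t e + 1 /\ (t e = pair i j /\ R e i j))).
  - intros e. split; [firstorder|]. intros (i & j & E & H). rewrite E.
    exists i. split; [apply lt_succ_le, le_pair_l|].
    exists j. split; [apply lt_succ_le, le_pair_r | auto].
  - apply (Delta1_bex (fun e i => exists j, j < t e + 1 /\ (t e = pair i j /\ R e i j))
      (fun e => t e + 1)); [apply term_add; [exact Ht | apply term_const]|].
    apply (Delta1_bex (fun e j => t (fun i => e (S i)) = pair (e 0%nat) j /\
      R (fun i => e (S i)) (e 0%nat) j) (fun e => t (fun i => e (S i)) + 1));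
      [apply term_add; [now apply term_shift | apply term_const]|].
    apply Delta1_and; [|exact HR]. apply Delta0_Delta1, Delta0_eq.
    + now apply (term_shift (fun e => t (fun i => e (S i)))), term_shift.
    + apply term_pair; apply term_var.
Qed.

(** A quantifier over standard numbers unfolds to a finite disjunction, so each [a] may come with a
    formula of its own. *)
Lemma Delta1_ex_meta (R : nat -> (nat -> num M) -> Prop) (b : nat) :
  (forall a, Delta1 (R a)) -> Delta1 (fun e => exists a, (a < b)%nat /\ R a e).
Proof.
  intros H. induction b as [|b IH].
  - apply (Delta1_ext (fun _ => False)).
    + intros e. split; [tauto|]. intros (a & Ha & _). lia.
    + apply Delta0_Delta1, Delta0_const.
  - apply (Delta1_ext (fun e => R b e \/ exists a, (a < b)%nat /\ R a e)).
    + intros e. split.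
      * intros [Hb | (a & Ha & Hb)]; [exists b | exists a]; split; auto; lia.
      * intros (a & Ha & Hb). destruct (Nat.eq_dec a b) as [-> |]; [now left|].
        right. exists a. split; [lia | exact Hb].
    + now apply Delta1_or.
Qed.

End Complexity.

(** Redefined below whenever further predicates have been shown to be Delta^0_1. *)
Ltac definable_Delta1_hook := fail.

Ltac definable_term ::=
  cbv beta;
  first [ assumption | apply term_var | apply term_const
        | apply term_add; definable_term | apply term_mul; definable_term
        | apply term_pair; definable_term ].

Ltac definable :=
  cbv beta;
  lazymatch goal with
  | |- term_def _ => definable_term
  | |- Delta0 _ => definable_Delta0
  | |- Delta1 _ =>
    first [ assumption
          | apply Delta0_Delta1, Delta0_const
          | apply Delta0_Delta1, Delta0_eq; definable_term
          | apply Delta0_Delta1, Delta0_lt; definable_term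
          | apply Delta0_Delta1, Delta0_mem; definable_term
          | definable_Delta1_hook
          | apply Delta1_not; definable
          | apply Delta1_and; definable
          | apply Delta1_or; definable
          | apply Delta1_iff; definable
          | apply Delta1_imp; definable
          | apply Delta1_ball; definable
          | apply Delta1_bex; definable
          | apply Delta1_ex_pair; definable
          | apply Delta1_ex_meta; intros ?; definable ]
  | |- Sigma1 _ =>
    first [ assumption
          | apply Delta1_Sigma1; solve [definable]
          | apply Sigma1_and; definable
          | apply Sigma1_or; definable
          | apply Sigma1_imp; definable
          | apply Sigma1_ball; definable
          | apply Sigma1_ex; definable ]
  end.

(** * Induction, comprehension and least elements for definable predicates *)

Section Principles.

Context {M : L2_structure} {HM : RCA0 M}.
Implicit Types (x y z a b c d i j k m n : num M).

Lemma Sigma1_induct (R : num M -> Prop) : Sigma1 (fun e => R (e 0%nat)) ->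
  R 0 -> (forall n, R n -> R (n + 1)) -> forall n, R n.
Proof.
  intros (A & HA & HR) H0 HS n.
  destruct (induction_matrix _ _ HA HA) as (F & G & e0 & E & Hsat).
  assert (H : forall n, sat_Sigma1 (env_cons n e0) E F <-> R n).
  { intros k. rewrite (proj1 (Hsat k)). symmetry. apply (HR (env_cons k e0)). }
  apply H, (Sigma1_induction M HM).
  - now apply H.
  - intros k. rewrite !H. apply HS.
Qed.

Lemma comprehension (R : num M -> Prop) : Delta1 (fun e => R (e 0%nat)) ->
  exists X : set M, forall n, n ∈ X <-> R n.
Proof.
  intros [(A & HA & HR) (B & HB & HR')].
  destruct (induction_matrix _ _ HA HB) as (F & G & e0 & E & Hsat).
  assert (H : forall n, sat_Sigma1 (env_cons n e0) E F <-> R n).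
  { intros k. rewrite (proj1 (Hsat k)). symmetry. apply (HR (env_cons k e0)). }
  destruct (Delta1_comprehension M HM F (f_not G) e0 E) as [X HX].
  - intros n. rewrite H. unfold sat_Pi1. simpl.
    assert (H' : sat_Sigma1 (env_cons n e0) E G <-> ~ R n).
    { rewrite (proj2 (Hsat n)). symmetry. apply (HR' (env_cons n e0)). }
    unfold sat_Sigma1 in H'. split.
    + intros Hn m Hm. apply H'; [now exists m | exact Hn].
    + intros Hn. apply NNPP. intros C. apply H' in C as [m Hm]. now apply (Hn m).
  - exists X. intros n. now rewrite HX.
Qed.

Lemma rel_comprehension (R : num M -> num M -> Prop) :
  Delta1 (fun e => R (e 1%nat) (e 0%nat)) ->
  exists X : set M, (forall x y, pair x y ∈ X <-> R x y) /\
    forall z, z ∈ X -> exists x y, z = pair x y.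
Proof.
  intros HR. destruct (comprehension (fun z => exists x y, z = pair x y /\ R x y))
    as [X HX].
  - apply (Delta1_ex_pair (fun _ => R) (fun e => e 0%nat)); [definable | exact HR].
  - exists X. split.
    + intros x y. rewrite HX. split; [|now exists x, y].
      intros (x' & y' & E & H). now apply pair_inj in E as [-> ->].
    + intros z Hz. apply HX in Hz as (x & y & E & _). now exists x, y.
Qed.

(** Once comprehension has turned [R] into a set, having no element below [m] is a bounded formula,
    open to induction. *)
Lemma least_number (R : num M -> Prop) : Delta1 (fun e => R (e 0%nat)) ->
  (exists n, R n) -> exists n, R n /\ forall k, k < n -> ~ R k.
Proof.
  intros HR [n Hn]. destruct (comprehension R HR) as [X HX].
  apply NNPP. intros H.
  assert (K : forall n, forall k, k < n -> ~ k ∈ X).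
  { intros m. Delta0_induct m.
    - intros k Hk. now destruct (not_lt_zero M HM k).
    - intros m IH k Hk. apply (lt_succ M HM) in Hk as [Hk | ->]; [auto|].
      intros Hm. apply H. exists m. split; [now apply HX|].
      intros k Hk Rk. apply (IH k Hk). now apply HX. }
  apply (K (n + 1) n (lt_one_succ n)). now apply HX.
Qed.

End Principles.

(** * Codes of finite sets *)

Section FiniteSets.

Context {M : L2_structure} {HM : RCA0 M}.
Implicit Types (x y z a b c d i j k m n : num M) (s t : (nat -> num M) -> num M).

Add Ring num_ring2 : (num_semiring (M := M)).

Lemma Delta1_divides s t : term_def s -> term_def t ->
  Delta1 (fun e => divides (s e) (t e)).
Proof.
  intros Hs Ht.
  apply (Delta1_ext (fun e => exists q, q < t e + 1 /\ t e = s e * q)).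
  - intros e. split; [firstorder|]. intros [q Hq].
    (* A zero divisor puts no bound on the quotient; then 0 serves as one. *)
    destruct (zero_or_succ (s e)) as [E | [p E]].
    + exists 0. split; [apply lt_zero_succ|]. rewrite Hq, E. ring.
    + exists q. split; [|exact Hq]. apply lt_succ_le. rewrite Hq, E.
      exists (p * q). ring.
  - apply (Delta1_bex (fun e q => t e = s e * q) (fun e => t e + 1)).
    + apply term_add; [exact Ht | apply term_const].
    + apply Delta0_Delta1, Delta0_eq; [now apply term_shift|].
      apply term_mul; [now apply term_shift | apply term_var].
Qed.

Lemma fin_mem_iff i c : fin_mem i c <->
  exists k z, c = pair k z /\ exists m n, z = pair m n /\
    i < k /\ divides (m * (i + 1) + 1) n.
Proof.
  split.
  - intros (k & m & n & E & H). exists k, (pair m n). split; [exact E|].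
    now exists m, n.
  - intros (k & z & E & m & n & E' & H). exists k, m, n. subst z. tauto.
Qed.

Lemma fin_mem_lt i c : fin_mem i c -> i < c.
Proof.
  intros (k & m & n & -> & H & _). exact (lt_le_trans _ _ _ H (le_pair_l _ _)).
Qed.

Lemma Delta1_fin_mem s t : term_def s -> term_def t ->
  Delta1 (fun e => fin_mem (s e) (t e)).
Proof.
  intros Hs Ht. eapply Delta1_ext; [intros e; symmetry; apply fin_mem_iff|].
  apply Delta1_ex_pair; [exact Ht|].
  apply (Delta1_ex_pair (fun e m n => s (fun i : nat => e (S (S i))) < e 1%nat /\
    divides (m * (s (fun i : nat => e (S (S i))) + 1) + 1) n) (fun e => e 0%nat));
    [apply term_var|].
  pose proof (term_shift _ (term_shift _ (term_shift _ (term_shift _ Hs)))) as Hs4.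
  apply Delta1_and.
  - apply Delta0_Delta1, Delta0_lt; [exact Hs4 | definable_term].
  - apply Delta1_divides; [|definable_term].
    apply term_add; [apply term_mul; [definable_term|]|]; [|definable_term].
    apply term_add; [exact Hs4 | definable_term].
Qed.

(** The product of the terms, built by Sigma^0_1 induction. The case [m = 1], [v = 0] provides a
    multiple of 1, ..., [k], the case [v = 1] a multiple of all moduli of the coding. *)
Lemma common_multiple m v k : (forall i, 0 < m * (i + 1) + v) ->
  exists n, 0 < n /\ forall i, i < k -> divides (m * (i + 1) + v) n.
Proof.
  intros Hp. pattern k. revert k. apply Sigma1_induct.
  - apply (Sigma1_ex (fun e n => 0 < n /\ forall i, i < e 0%nat -> divides (m * (i + 1) + v) n)).
    apply Sigma1_and; [definable|]. apply Delta1_Sigma1.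
    apply (Delta1_ball (fun e i => divides (m * (i + 1) + v) (e 0%nat))); [definable|].
    apply Delta1_divides; definable.
  - exists 1. split; [rewrite <- (zero_add 1); apply lt_zero_succ|].
    intros i Hi. now destruct (not_lt_zero M HM i).
  - intros k (n & Hn & H). exists ((m * (k + 1) + v) * n). split.
    + now apply mul_pos.
    + intros i Hi. apply (lt_succ M HM) in Hi as [Hi | ->].
      * destruct (H i Hi) as [q ->]. exists ((m * (k + 1) + v) * q). ring.
      * now exists n.
Qed.

(** [b] is invertible modulo [a], stated without subtraction. *)
Definition invertible a b : Prop := exists x y, b * y = a * x + 1.

(** With B = [b + 1 + 1], multiply B y = a x + 1 by B - 1, which is -1 modulo B: then a x (B - 1) =
    B (y (B - 1) - 1) + 1. Writing B as a double successor avoids subtraction. *)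
Lemma invertible_sym a b : invertible a (b + 1 + 1) -> invertible (b + 1 + 1) a.
Proof.
  intros (x & y & H). destruct (zero_or_succ y) as [-> | [z ->]].
  - destruct (succ_neq_zero M HM (a * x)). rewrite <- H. ring.
  - exists (z * (b + 1) + b), (x * (b + 1)). apply (add_cancel_r _ _ (b + 1)).
    transitivity ((a * x + 1) * (b + 1)); [ring|]. rewrite <- H. ring.
Qed.

(** From b y = a x + 1 and b q = a w one gets q = a (w y - x q). What remains is that this
    difference of cofactors is not negative. *)
Lemma invertible_cancel a b q : a <> 0 -> invertible a b -> divides a (b * q) ->
  divides a q.
Proof.
  intros Ha (x & y & H) [w Hw].
  assert (E : a * (x * q) + q = a * (w * y)).
  { transitivity ((a * x + 1) * q); [ring|]. rewrite <- H.
    transitivity (b * q * y); [ring|]. rewrite Hw. ring. }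
  revert E. generalize (x * q), (w * y). intros u v E.
  destruct (lt_or_le v u) as [L | [d ->]].
  - exfalso. apply lt_iff in L as [d ->].
    assert (Z : a * (d + 1) + q = 0).
    { apply (add_cancel_l _ _ (a * v)). rewrite add_zero by assumption.
      rewrite <- E at 2. ring. }
    apply add_eq_zero, mul_eq_zero in Z as [Z | Z]; [contradiction|].
    now destruct (succ_neq_zero M HM d).
  - exists d. apply (add_cancel_l _ _ (a * u)). rewrite E. ring.
Qed.

(** Let [j = i + d + 1] and [m = (d + 1) * u]. Modulo [m * (i + 1) + 1] the other modulus is
    [m * (d + 1)]. The inverse of [m] there is [v], congruent to -(i + 1), so the inverse of [d + 1]
    is [u * v], and together they give [u * v * v]. *)
Lemma invertible_moduli k m i j : 0 < m ->
  (forall i, i < k -> divides (i + 1) m) -> i < k -> j < k -> i <> j ->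
  invertible (m * (i + 1) + 1) (m * (j + 1) + 1).
Proof.
  intros Hm Hk. apply pos_neq_zero in Hm.
  destruct (zero_or_succ m) as [E | [p Hp]]; [contradiction|].
  assert (K : forall i j, i < j -> j < k ->
      invertible (m * (i + 1) + 1) (m * (j + 1) + 1)).
  { clear i j. intros i j Hij Hj. apply lt_iff in Hij as [d ->].
    destruct (Hk d) as [u Hu].
    { apply (le_lt_trans _ (i + d + 1)); [exists (i + 1); ring | exact Hj]. }
    pose (v := p * (i + 1) + 1).
    assert (Hv : m * v = (m * (i + 1) + 1) * p + 1) by (unfold v; rewrite Hp; ring).
    revert Hv. generalize v. clear v. intros v Hv.
    exists (u * v * v + (m * (i + 1) + 1) * p * p + (1 + 1) * p), (u * v * v).
    transitivity ((m * (i + 1) + 1) * (u * v * v) + (m * v) * (((d + 1) * u) * v));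
      [ring|].
    rewrite <- Hu, Hv. ring. }
  intros Hi Hj Hij. destruct (trichotomy i j) as [L | [L | L]]; [auto|contradiction|].
  pose proof (K j i L Hi) as H. revert H.
  replace (m * (i + 1) + 1) with (p * (i + 1) + i + 1 + 1) by (rewrite Hp; ring).
  apply invertible_sym.
Qed.

(** [b] carries a modulus that codes every subset of [[0, k)] by a number
    at most [b]. *)
Definition frame k b : Prop :=
  exists z, b = pair k z /\ exists m n, z = pair m n /\ 0 < m /\ 0 < n /\
    forall i, i < k -> divides (i + 1) m /\ divides (m * (i + 1) + 1) n.

Lemma frame_exists k : exists b, frame k b.
Proof.
  destruct (common_multiple 1 0 k) as (m & Hm & H).
  { intros i. replace (1 * (i + 1) + 0) with (i + 1) by ring. apply lt_zero_succ. }
  destruct (common_multiple m 1 k) as (n & Hn & H').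
  { intros i. apply lt_zero_succ. }
  exists (pair k (pair m n)), (pair m n). split; [reflexivity|].
  exists m, n. do 3 (split; [auto|]). intros i Hi. split; [|auto].
  replace (i + 1) with (1 * (i + 1) + 0) by ring. auto.
Qed.

Lemma fin_mem_pair i k m n :
  fin_mem i (pair k (pair m n)) <-> i < k /\ divides (m * (i + 1) + 1) n.
Proof.
  split; [|now exists k, m, n].
  intros (k' & m' & n' & E & H). apply pair_inj in E as [-> E].
  now apply pair_inj in E as [-> ->].
Qed.

(** The least common multiple of the moduli [m (i + 1) + 1] with [R i] is not
    divisible by any other modulus [d]: otherwise its quotient by [d] would be a
    smaller common multiple. *)
Lemma frame_represents k b (R : num M -> Prop) :
  Delta1 (fun e => R (e 0%nat)) -> frame k b ->
  exists c, c < b + 1 /\ represents_set c /\ forall i, fin_mem i c <-> i < k /\ R i.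
Proof.
  intros HR (z & -> & m & p & -> & Hm & Hp & H).
  destruct (least_number (fun n => 0 < n /\
    forall i, i < k -> R i -> divides (m * (i + 1) + 1) n)) as (n & [Hn Hd] & Hmin).
  - apply Delta1_and; [definable|].
    apply (Delta1_ball (fun e i => R i -> divides (m * (i + 1) + 1) (e 0%nat)));
      [definable|].
    apply Delta1_imp; [exact HR | apply Delta1_divides; definable].
  - exists p. split; [exact Hp|]. intros i Hi _. now apply H.
  - exists (pair k (pair m n)). split; [|split].
    + apply lt_succ_le, pair_le; [apply le_refl|]. apply pair_le; [apply le_refl|].
      destruct (lt_or_le p n) as [L|L]; [|exact L]. exfalso. apply (Hmin p L).
      split; [exact Hp|]. intros i Hi _. now apply H.
    + now exists k, m, n.
    + intros j. rewrite fin_mem_pair. split; intros [Hj D]; (split; [exact Hj|]); auto.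
      apply NNPP. intros NR. destruct D as [q Hq].
      assert (Hq0 : 0 < q).
      { apply pos_neq_zero. intros ->. apply pos_neq_zero in Hn. apply Hn.
        rewrite Hq. ring. }
      apply (Hmin q).
      * pose proof (mul_pos _ _ (mul_pos _ _ Hm (lt_zero_succ j)) Hq0) as L.
        rewrite Hq. apply lt_iff in L as [d Hd']. apply lt_iff. exists d.
        transitivity (m * (j + 1) * q + q); [ring|]. rewrite Hd'. ring.
      * split; [exact Hq0|]. intros i Hi Ri.
        apply (invertible_cancel _ (m * (j + 1) + 1)).
        -- apply (succ_neq_zero M HM).
        -- apply (invertible_moduli k); auto.
           ++ intros i' Hi'. now apply H.
           ++ intros ->. contradiction.
        -- rewrite <- Hq. now apply Hd.
Qed.

Lemma Delta1_represents_set t : term_def t ->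
  Delta1 (fun e => represents_set (t e)).
Proof.
  intros Ht. apply (Delta1_ext (fun e => exists k z, t e = pair k z /\
    exists m n, z = pair m n /\ (0 : num M) = 0)).
  - intros e. split.
    + intros (k & z & E & m & n & -> & _). now exists k, m, n.
    + intros (k & m & n & E). exists k, (pair m n). split; [exact E|]. now exists m, n.
  - apply Delta1_ex_pair; [exact Ht|].
    apply (Delta1_ex_pair (fun _ _ _ => (0 : num M) = 0) (fun e => e 0%nat)); definable.
Qed.

Lemma same_members_bounded c d : (forall i, fin_mem i c <-> fin_mem i d) <->
  forall i, i < c + d -> (fin_mem i c <-> fin_mem i d).
Proof.
  split; [auto|]. intros H i. split; intros Hi; apply H; auto;
    apply fin_mem_lt in Hi; apply (lt_le_trans _ _ _ Hi);
    [apply le_add_r | apply le_add_l].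
Qed.

Lemma Delta1_fin_set_code t : term_def t -> Delta1 (fun e => fin_set_code (t e)).
Proof.
  intros Ht. apply Delta1_and; [now apply Delta1_represents_set|].
  apply (Delta1_ball (fun e d => represents_set d ->
    ~ (forall i, fin_mem i d <-> fin_mem i (t e)))); [exact Ht|].
  pose proof (term_shift _ Ht) as Ht1. pose proof (term_shift _ Ht1) as Ht2.
  apply Delta1_imp; [apply Delta1_represents_set; definable|].
  apply Delta1_not.
  eapply Delta1_ext; [intros e; symmetry; apply same_members_bounded|].
  apply (Delta1_ball (fun e i => fin_mem i (e 0%nat) <-> fin_mem i (t (fun i : nat => e (S i))))
    (fun e => e 0%nat + t (fun i : nat => e (S i)))).
  - apply term_add; [definable | exact Ht1].
  - apply Delta1_iff; apply Delta1_fin_mem; first [exact Ht2 | definable].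
Qed.

(** A representative [c0] inside the frame exists, and the code is the least number with the same
    members. Members are smaller than their code, so comparing them below [c + c0] suffices and is
    decidable. *)
Lemma frame_code k b (R : num M -> Prop) :
  Delta1 (fun e => R (e 0%nat)) -> frame k b ->
  exists c, c < b + 1 /\ fin_set_code c /\ forall i, fin_mem i c <-> i < k /\ R i.
Proof.
  intros HR Hb. destruct (frame_represents k b R HR Hb) as (c0 & Hc0 & R0 & H0).
  assert (Hbd : forall c, (forall i, i < c + c0 -> (fin_mem i c <-> fin_mem i c0)) <->
      forall i, fin_mem i c <-> i < k /\ R i).
  { intros c. rewrite <- same_members_bounded. split; intros H i.
    - now rewrite H.
    - now rewrite H, H0. }
  destruct (least_number (fun c => represents_set c /\
    forall i, i < c + c0 -> (fin_mem i c <-> fin_mem i c0))) as (c & [Hc Hi] & Hmin).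
  - apply Delta1_and; [apply Delta1_represents_set; definable|].
    apply (Delta1_ball (fun e i => fin_mem i (e 0%nat) <-> fin_mem i c0)
      (fun e => e 0%nat + c0)); [definable|].
    apply Delta1_iff; apply Delta1_fin_mem; definable.
  - exists c0. split; [exact R0|]. tauto.
  - pose proof (proj1 (Hbd c) Hi) as Hc_mem. exists c. split; [|split; [split|]]; auto.
    + destruct (lt_or_le c0 c) as [L|L].
      * exfalso. apply (Hmin c0 L). split; [exact R0|]. tauto.
      * apply lt_succ_le in L. apply (lt_le_trans _ _ _ L).
        rewrite lt_succ_le in Hc0. apply add_le; [exact Hc0 | apply le_refl].
    + intros d Hd Rd H. apply (Hmin d Hd). split; [exact Rd|]. apply (proj2 (Hbd d)).
      intros i. rewrite H. apply Hc_mem.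
Qed.

Lemma fin_set_code_ext c d : fin_set_code c -> fin_set_code d ->
  (forall i, fin_mem i c <-> fin_mem i d) -> c = d.
Proof.
  intros [Hc Mc] [Hd Md] H. destruct (trichotomy c d) as [L | [L | L]]; [|exact L|].
  - now destruct (Md c L Hc).
  - destruct (Mc d L Hd). intros i. now rewrite H.
Qed.

End FiniteSets.

(** * Binary sequences *)

Ltac definable_Delta1_hook ::=
  first [ apply Delta1_divides; definable_term
        | apply Delta1_fin_mem; definable_term
        | apply Delta1_represents_set; definable_term
        | apply Delta1_fin_set_code; definable_term
        | progress unfold frame, seq_entry, maps_to, fiber, rel_lt, rel_le; definable ].

Section Sequences.

Context {M : L2_structure} {HM : RCA0 M}.
Implicit Types (s t : num M).

Add Ring num_ring3 : (num_semiring (M := M)).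

Lemma seq_entry_lt s i j : seq_entry s i j -> i < s /\ j < s.
Proof.
  intros H. apply fin_mem_lt in H. split; apply (fun L => le_lt_trans _ _ _ L H).
  - apply le_pair_l.
  - apply le_pair_r.
Qed.

Lemma seq_length_le s l : seq_length s l -> le l s.
Proof.
  intros H. destruct (zero_or_succ l) as [-> | [m ->]]; [apply zero_le|].
  destruct (proj1 (H m) (lt_one_succ m)) as [j Hj]. apply seq_entry_lt in Hj as [L _].
  apply lt_iff in L as [d ->]. exists d. ring.
Qed.

Lemma seq_length_unique s k l : seq_length s k -> seq_length s l -> k = l.
Proof.
  intros Hk Hl. destruct (trichotomy k l) as [L | [L | L]]; [|exact L|].
  - apply Hl, Hk in L. now apply lt_irrefl in L.
  - apply Hk, Hl in L. now apply lt_irrefl in L.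
Qed.

Lemma Delta1_seq_length (a b : (nat -> num M) -> num M) : term_def a -> term_def b ->
  Delta1 (fun e => seq_length (a e) (b e)).
Proof.
  (* From [b e + a e] on, [i] is neither below the length nor the index of an entry, so both sides
     of the equivalence fail. *)
  intros Ha Hb. apply (Delta1_ext (fun e => forall i, i < b e + a e ->
    (i < b e <-> exists j, j < a e /\ seq_entry (a e) i j))).
  - intros e. split; intros H i.
    + assert (K : (exists j, j < a e /\ seq_entry (a e) i j) <->
        exists j, seq_entry (a e) i j).
      { split; [intros (j & _ & Hj); now exists j|]. intros [j Hj]. exists j. split; [|exact Hj].
        apply (seq_entry_lt _ _ _ Hj). }
      rewrite <- K. destruct (lt_or_le (b e + a e) i) as [L|L].
      * split; intros Hi.
        -- destruct (lt_not_le _ _ Hi). apply lt_le, (le_lt_trans _ (b e + a e));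
           [apply le_add_r | exact L].
        -- destruct Hi as (j & _ & Hj). apply seq_entry_lt in Hj as [Hi _].
           destruct (lt_not_le _ _ Hi). apply lt_le, (le_lt_trans _ (b e + a e));
           [apply le_add_l | exact L].
      * apply le_lt_or_eq in L as [L | ->]; [now apply H|].
        split; intros Hi.
        -- destruct (lt_not_le _ _ Hi). apply le_add_r.
        -- destruct Hi as (j & _ & Hj). apply seq_entry_lt in Hj as [Hi _].
           destruct (lt_not_le _ _ Hi). apply le_add_l.
    + intros _. rewrite (H i). split; [|intros (j & _ & Hj); now exists j]. intros [j Hj]. exists j.
      split; [|exact Hj]. apply (seq_entry_lt _ _ _ Hj).
  - pose proof (term_shift _ Ha) as Ha1. pose proof (term_shift _ Ha1) as Ha2.
    pose proof (term_shift _ Hb) as Hb1.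
    apply (Delta1_ball (fun e i => i < b e <-> exists j, j < a e /\ seq_entry (a e) i j)
      (fun e => b e + a e)); [now apply term_add|].
    apply Delta1_iff.
    + apply Delta0_Delta1, Delta0_lt; [definable | exact Hb1].
    + apply (Delta1_bex (fun e j => seq_entry (a (fun i => e (S i))) (e 0%nat) j)
        (fun e => a (fun i => e (S i)))); [exact Ha1|].
      apply Delta1_fin_mem; [definable | exact Ha2].
Qed.

Lemma Delta1_fin_seq (a : (nat -> num M) -> num M) : term_def a ->
  Delta1 (fun e => fin_seq (a e)).
Proof.
  intros Ha. pose proof (term_shift _ Ha) as Ha1.
  pose proof (term_shift _ Ha1) as Ha2. pose proof (term_shift _ Ha2) as Ha3.
  apply Delta1_and; [now apply Delta1_fin_set_code|].
  apply Delta1_and; [|apply Delta1_and].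
  - apply (Delta1_ext (fun e => forall z, z < a e -> fin_mem z (a e) ->
      exists i j, z = pair i j /\ (0 : num M) = 0)).
    + intros e. split.
      * intros H z Hz. destruct (H z (fin_mem_lt _ _ Hz) Hz) as (i & j & E & _).
        now exists i, j.
      * intros H z _ Hz. destruct (H z Hz) as (i & j & E). now exists i, j.
    + apply (Delta1_ball (fun e z => fin_mem z (a e) ->
        exists i j, z = pair i j /\ (0 : num M) = 0)); [exact Ha|].
      apply Delta1_imp; [apply Delta1_fin_mem; [definable | exact Ha1] | definable].
  - apply (Delta1_ext (fun e => forall i, i < a e -> forall j, j < a e ->
      forall k, k < a e -> (seq_entry (a e) i j -> seq_entry (a e) i k -> j = k))).
    + intros e. split; [|intros H i _ j _ k _; apply H].
      intros H i j k Hj Hk.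
      destruct (seq_entry_lt _ _ _ Hj), (seq_entry_lt _ _ _ Hk). now apply (H i).
    + apply (Delta1_ball (fun e i => forall j, j < a e ->
        forall k, k < a e -> (seq_entry (a e) i j -> seq_entry (a e) i k -> j = k)));
        [exact Ha|].
      apply (Delta1_ball (fun e j => forall k, k < a (fun i => e (S i)) ->
        (seq_entry (a (fun i => e (S i))) (e 0%nat) j ->
         seq_entry (a (fun i => e (S i))) (e 0%nat) k -> j = k))
        (fun e => a (fun i => e (S i)))); [exact Ha1|].
      apply (Delta1_ball (fun e k =>
        (seq_entry (a (fun i => e (S (S i)))) (e 1%nat) (e 0%nat) ->
         seq_entry (a (fun i => e (S (S i)))) (e 1%nat) k -> e 0%nat = k))
        (fun e => a (fun i => e (S (S i))))); [exact Ha2|].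
      apply Delta1_imp; [apply Delta1_fin_mem; [definable | exact Ha3]|].
      apply Delta1_imp; [apply Delta1_fin_mem; [definable | exact Ha3] | definable].
  - apply (Delta1_ext (fun e => exists l, l < a e + 1 /\ seq_length (a e) l)).
    + intros e. split; [intros (l & _ & Hl); now exists l|]. intros [l Hl]. exists l. split; [|exact Hl].
      now apply lt_succ_le, seq_length_le.
    + apply (Delta1_bex (fun e l => seq_length (a e) l) (fun e => a e + 1)).
      * apply term_add; [exact Ha | definable].
      * apply Delta1_seq_length; [exact Ha1 | definable].
Qed.

Lemma Delta1_binary_seq (a : (nat -> num M) -> num M) : term_def a ->
  Delta1 (fun e => binary_seq (a e)).
Proof.
  intros Ha. pose proof (term_shift _ Ha) as Ha1. pose proof (term_shift _ Ha1) as Ha2.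
  apply Delta1_and; [now apply Delta1_fin_seq|].
  apply (Delta1_ext (fun e => forall i, i < a e -> forall j, j < a e ->
    (seq_entry (a e) i j -> j = 0 \/ j = 1))).
  - intros e. split; [|intros H i _ j _; apply H]. intros H i j Hj.
    destruct (seq_entry_lt _ _ _ Hj). now apply (H i).
  - apply (Delta1_ball (fun e i => forall j, j < a e ->
      (seq_entry (a e) i j -> j = 0 \/ j = 1))); [exact Ha|].
    apply (Delta1_ball (fun e j => seq_entry (a (fun i => e (S i))) (e 0%nat) j ->
      j = 0 \/ j = 1) (fun e => a (fun i => e (S i)))); [exact Ha1|].
    apply Delta1_imp; [apply Delta1_fin_mem; [definable | exact Ha2] | definable].
Qed.

Lemma Delta1_initial_segment (a b : (nat -> num M) -> num M) : term_def a -> term_def b ->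
  Delta1 (fun e => initial_segment (a e) (b e)).
Proof.
  intros Ha Hb. pose proof (term_shift _ Ha) as Ha1. pose proof (term_shift _ Ha1) as Ha2.
  pose proof (term_shift _ (term_shift _ Hb)) as Hb2.
  apply (Delta1_ext (fun e => forall i, i < a e -> forall j, j < a e ->
    (seq_entry (a e) i j -> seq_entry (b e) i j))).
  - intros e. split.
    + intros H i j Hj. destruct (seq_entry_lt _ _ _ Hj). now apply H.
    + intros H i _ j _. apply H.
  - apply (Delta1_ball (fun e i => forall j, j < a e ->
      (seq_entry (a e) i j -> seq_entry (b e) i j))); [exact Ha|].
    apply (Delta1_ball (fun e j => seq_entry (a (fun i => e (S i))) (e 0%nat) j ->
      seq_entry (b (fun i => e (S i))) (e 0%nat) j) (fun e => a (fun i => e (S i))));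
      [exact Ha1|].
    apply Delta1_imp; (apply Delta1_fin_mem; [definable | assumption]).
Qed.

Lemma binary_entry_unique s i : binary_seq s ->
  seq_entry s i 0 -> seq_entry s i 1 -> False.
Proof.
  intros [(_ & _ & F & _) _] H0 H1. pose proof (F i 0 1 H0 H1) as E.
  apply (succ_neq_zero M HM 0). now rewrite zero_add.
Qed.

Lemma binary_entry_cases s l i : binary_seq s -> seq_length s l -> i < l ->
  seq_entry s i 0 \/ seq_entry s i 1.
Proof.
  intros [_ B] L Hi. apply L in Hi as [j Hj].
  destruct (B _ _ Hj) as [-> | ->]; auto.
Qed.

Lemma binary_seq_ext s t l : binary_seq s -> binary_seq t ->
  seq_length s l -> seq_length t l ->
  (forall i, i < l -> (seq_entry s i 1 <-> seq_entry t i 1)) -> s = t.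
Proof.
  assert (K : forall s t, binary_seq s -> binary_seq t ->
      seq_length s l -> seq_length t l ->
      (forall i, i < l -> (seq_entry s i 1 <-> seq_entry t i 1)) ->
      forall i, fin_mem i s -> fin_mem i t).
  { clear s t. intros s t Bs Bt Ls Lt H z Hz.
    destruct Bs as [(_ & G & Fs & _) Bs]. destruct (G z Hz) as (i & j & ->).
    assert (Hi : i < l) by (apply Ls; now exists j).
    destruct (Bs _ _ Hz) as [-> | ->]; [|now apply H].
    destruct (binary_entry_cases t l i Bt Lt Hi) as [E|E]; [exact E|].
    apply H in E; [|exact Hi]. pose proof (Fs _ _ _ Hz E) as C.
    destruct (succ_neq_zero M HM 0). now rewrite zero_add. }
  intros Bs Bt Ls Lt H. apply fin_set_code_ext.
  - apply Bs.
  - apply Bt.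
  - intros i. split; apply K; auto. intros k Hk. now rewrite H.
Qed.

Lemma zero_neq_one : (0 : num M) <> 1.
Proof. intros E. apply (succ_neq_zero M HM 0). now rewrite zero_add. Qed.

(** Hence a binary sequence of length [l] is a subset of [0, [pair l 1]), and frames for [pair l 1]
    suffice to code it. *)
Lemma binary_entry_code (l i j : num M) : i < l -> j = 0 \/ j = 1 -> pair i j < pair l 1.
Proof.
  intros Hi Hj. apply pair_lt, (lt_le_trans _ (l + j)).
  - apply lt_iff in Hi as [d ->]. apply lt_iff. exists d. ring.
  - apply add_le; [apply le_refl|]. destruct Hj as [-> | ->]; [apply zero_le | apply le_refl].
Qed.

Lemma binary_seq_exists l (R : num M -> Prop) : Delta1 (fun e => R (e 0%nat)) ->
  exists s, binary_seq s /\ seq_length s l /\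
    forall i, i < l -> (seq_entry s i 1 <-> R i).
Proof.
  intros HR. destruct (frame_exists (pair l 1)) as [b Hb].
  destruct (frame_code (pair l 1) b (fun z => exists i j, z = pair i j /\
    (i < l /\ ((R i /\ j = 1) \/ (~ R i /\ j = 0))))) as (s & _ & Cs & Ms);
    [|exact Hb|].
  - apply (Delta1_ex_pair (fun _ i j => i < l /\ ((R i /\ j = 1) \/ (~ R i /\ j = 0)))
      (fun e => e 0%nat)); [definable|].
    assert (HR1 : Delta1 (fun e => R (e 1%nat))) by (apply (Delta1_var R 1), HR).
    definable.
  - assert (E : forall i j, seq_entry s i j <->
        i < l /\ ((R i /\ j = 1) \/ (~ R i /\ j = 0))).
    { intros i j. unfold seq_entry. rewrite Ms. split.
      - intros (_ & i' & j' & P & H). now apply pair_inj in P as [-> ->].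
      - intros H. split; [|now exists i, j]. apply binary_entry_code; tauto. }
    assert (L : seq_length s l).
    { intros i. split.
      - intros Hi. destruct (classic (R i)); [exists 1 | exists 0]; apply E; auto.
      - intros [j Hj]. now apply E in Hj. }
    exists s. split; [split; [split; [exact Cs|split; [|split]]|]|].
    + intros z Hz. apply Ms in Hz as (_ & i & j & P & _). now exists i, j.
    + intros i j k Hj Hk. apply E in Hj as [_ Hj], Hk as [_ Hk].
      destruct Hj as [[? ->] | [? ->]], Hk as [[? ->] | [? ->]]; tauto.
    + now exists l.
    + intros i j Hj. apply E in Hj. tauto.
    + split; [exact L|]. intros i Hi. rewrite E. pose proof zero_neq_one. intuition.
      congruence.
Qed.

(** Coding the members of [s] anew inside the frame yields [s] again, since codes are unique. The
    bound depends on [n] alone and so covers all binary sequences of length up to [n] at once. *)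
Lemma binary_seq_bound s l n b : binary_seq s -> seq_length s l -> le l n ->
  frame (pair n 1) b -> s < b + 1.
Proof.
  intros Bs Ls Hl Hb.
  destruct (frame_code (pair n 1) b (fun z => fin_mem z s)) as (t & Ht & Ct & Mt);
    [definable | exact Hb|].
  replace s with t; [exact Ht|]. apply fin_set_code_ext; [exact Ct | apply Bs|].
  intros z. rewrite Mt. split; [tauto|]. intros Hz. split; [|exact Hz].
  destruct Bs as [(_ & G & _) Bs]. destruct (G z Hz) as (i & j & ->).
  apply binary_entry_code; [|now apply (Bs i)].
  apply (fun L => lt_le_trans _ _ _ L Hl), Ls. now exists j.
Qed.

Lemma binary_entry_agree s t k l i j : binary_seq s -> binary_seq t ->
  seq_length s k -> seq_length t l -> i < k -> i < l ->
  (seq_entry s i 1 <-> seq_entry t i 1) -> (seq_entry s i j <-> seq_entry t i j).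
Proof.
  assert (K : forall s t l j, binary_seq s -> binary_seq t -> seq_length t l -> i < l ->
      (seq_entry s i 1 <-> seq_entry t i 1) -> seq_entry s i j -> seq_entry t i j).
  { clear s t j k l. intros s t l j Bs Bt Lt Hi H Hj.
    destruct (proj2 Bs _ _ Hj) as [-> | ->]; [|now apply H].
    destruct (binary_entry_cases t l i Bt Lt Hi) as [E|E]; [exact E|].
    apply H in E. now destruct (binary_entry_unique s i Bs Hj). }
  intros Bs Bt Ls Lt Hk Hl H. split; [apply (K s t l) | apply (K t s k)]; auto. tauto.
Qed.

Lemma binary_seq_restrict s l k : binary_seq s -> seq_length s l -> le k l ->
  exists r, binary_seq r /\ seq_length r k /\ initial_segment r s.
Proof.
  intros Bs Ls Hk.
  destruct (binary_seq_exists k (fun i => seq_entry s i 1)) as (r & Br & Lr & H);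
    [definable|].
  exists r. split; [exact Br|]. split; [exact Lr|]. intros i j Hj.
  assert (Hi : i < k) by (apply Lr; now exists j).
  destruct (proj2 Br _ _ Hj) as [-> | ->]; [|now apply H].
  destruct (binary_entry_cases s l i Bs Ls (lt_le_trans _ _ _ Hi Hk)) as [E|E];
    [exact E|].
  apply H in E; [|exact Hi]. now destruct (binary_entry_unique r i Br Hj).
Qed.

Lemma initial_segment_entry r s k i j : seq_length r k -> fin_seq s ->
  initial_segment r s -> i < k -> (seq_entry r i j <-> seq_entry s i j).
Proof.
  intros Lr Fs H Hi. split; [apply H|]. intros Hj.
  apply Lr in Hi as [j' Hj']. destruct Fs as (_ & _ & F & _).
  now rewrite (F i j j' Hj (H _ _ Hj')).
Qed.

End Sequences.

Ltac definable_Delta1_hook ::=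
  first [ apply Delta1_divides; definable_term
        | apply Delta1_fin_mem; definable_term
        | apply Delta1_fin_seq; definable_term
        | apply Delta1_binary_seq; definable_term
        | apply Delta1_seq_length; definable_term
        | apply Delta1_initial_segment; definable_term
        | progress unfold frame, seq_entry, maps_to, fiber, rel_lt, rel_le; definable ].

(** * Compatible orders *)

Section CompatibleOrders.

Context {M : L2_structure} {HM : RCA0 M}.
Implicit Types (p q r x y z : num M) (P L R F f : set M).

Lemma linear_order_exists (D : num M -> Prop) (le : num M -> num M -> Prop) :
  Delta1 (fun e => D (e 0%nat)) -> Delta1 (fun e => le (e 1%nat) (e 0%nat)) ->
  (forall x, D x -> le x x) ->
  (forall x y z, D x -> D y -> D z -> le x y -> le y z -> le x z) ->
  (forall x y, D x -> D y -> le x y -> le y x -> x = y) ->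
  (forall x y, D x -> D y -> le x y \/ le y x) ->
  exists L leL, linear_order L leL /\ (forall x, x ∈ L <-> D x) /\
    forall x y, rel_le leL x y <-> D x /\ D y /\ le x y.
Proof.
  intros HD Hle Hr Ht Ha Hc.
  destruct (comprehension D HD) as [L HL].
  destruct (rel_comprehension (fun x y => D x /\ D y /\ le x y)) as (leL & E & S).
  { apply Delta1_and; [apply (Delta1_var D 1 HD)|]. now apply Delta1_and. }
  exists L, leL. split; [|now split]. unfold linear_order, partial_order, rel_le.
  split; [split; [|split; [|split]]|].
  - intros z Hz. destruct (S z Hz) as (x & y & ->). apply E in Hz.
    exists x, y. rewrite !HL. tauto.
  - intros p Hp. apply HL in Hp. apply E. auto.
  - intros p q r H1 H2. apply E in H1, H2. apply E. intuition eauto.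
  - intros p q H1 H2. apply E in H1, H2. apply Ha; tauto.
  - intros x y Hx Hy. rewrite !E. apply HL in Hx, Hy. destruct (Hc x y Hx Hy); tauto.
Qed.

Lemma function_exists P L (G : num M -> num M -> Prop) :
  Delta1 (fun e => G (e 1%nat) (e 0%nat)) ->
  (forall x, x ∈ P -> exists! y, G x y) ->
  (forall x y, x ∈ P -> G x y -> y ∈ L) ->
  exists f, is_function (mem P) (mem L) f /\
    forall x y, maps_to f x y <-> x ∈ P /\ G x y.
Proof.
  intros HG Hu HL.
  destruct (rel_comprehension (fun x y => x ∈ P /\ G x y)) as (f & E & S).
  { apply Delta1_and; [definable | exact HG]. }
  exists f. split; [split|exact E].
  - intros z Hz. destruct (S z Hz) as (x & y & ->). apply E in Hz as [Hx Hy].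
    exists x, y. eauto.
  - intros x Hx. destruct (Hu x Hx) as (y & Hy & U). exists y. split.
    + now apply E.
    + intros y' Hy'. apply E in Hy' as [_ Hy']. auto.
Qed.

Lemma partial_order_dom P leP p q : partial_order P leP -> rel_le leP p q ->
  p ∈ P /\ q ∈ P.
Proof.
  intros (S & _) H. destruct (S _ H) as (x & y & Hx & Hy & E).
  now apply pair_inj in E as [-> ->].
Qed.

Lemma rel_lt_le_trans P leP p q r : partial_order P leP ->
  rel_lt leP p q -> rel_le leP q r -> rel_lt leP p r.
Proof.
  intros (_ & _ & T & A) [H N] H'. split; [eauto|]. intros ->. apply N. now apply A.
Qed.

Lemma rel_le_lt_trans P leP p q r : partial_order P leP ->
  rel_le leP p q -> rel_lt leP q r -> rel_lt leP p r.
Proof.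
  intros (_ & _ & T & A) H [H' N]. split; [eauto|]. intros ->. apply N. now apply A.
Qed.

Lemma rel_lt_trans P leP p q r : partial_order P leP ->
  rel_lt leP p q -> rel_lt leP q r -> rel_lt leP p r.
Proof. intros HP H [H' _]. now apply (rel_lt_le_trans P leP p q r). Qed.

Lemma rel_lt_irrefl leP p : ~ rel_lt leP p p.
Proof. now intros []. Qed.

Lemma linear_not_le L leL x y : linear_order L leL -> x ∈ L -> y ∈ L ->
  (~ rel_le leL y x <-> rel_lt leL x y).
Proof.
  intros [(_ & _ & _ & A) T] Hx Hy. split.
  - intros H. destruct (T x y Hx Hy) as [H'|H']; [|contradiction].
    split; [exact H'|]. now intros ->.
  - intros [H N] H'. apply N. auto.
Qed.

(** A linear order of [P], the same in which both the left and the right endpoints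
    of a proper representation are arranged. *)
Record compatible_order P leP R : Prop := {
  compat_irrefl : forall p, p ∈ P -> ~ pair p p ∈ R;
  compat_trans : forall p q r, p ∈ P -> q ∈ P -> r ∈ P ->
    pair p q ∈ R -> pair q r ∈ R -> pair p r ∈ R;
  compat_total : forall p q, p ∈ P -> q ∈ P -> p <> q ->
    pair p q ∈ R \/ pair q p ∈ R;
  compat_l : forall p q r, p ∈ P -> q ∈ P -> r ∈ P ->
    rel_lt leP p q -> pair q r ∈ R -> rel_lt leP p r;
  compat_r : forall p q r, p ∈ P -> q ∈ P -> r ∈ P ->
    pair p q ∈ R -> rel_lt leP q r -> rel_lt leP p r
}.

Lemma compat_asym P leP R p q : compatible_order P leP R -> p ∈ P -> q ∈ P ->
  pair p q ∈ R -> pair q p ∈ R -> False.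
Proof.
  intros C Hp Hq H H'. apply (compat_irrefl _ _ _ C p Hp).
  now apply (compat_trans _ _ _ C p q p).
Qed.

Lemma compat_dec P leP R p q : compatible_order P leP R -> p ∈ P -> q ∈ P ->
  (p = q \/ pair p q ∈ R) \/ pair q p ∈ R.
Proof.
  intros C Hp Hq. destruct (classic (p = q)); [auto|].
  destruct (compat_total _ _ _ C p q); auto.
Qed.

(** [pair p 0] and [pair p 1] are the left and the right endpoint of [p]. *)
Definition endpoint_le leP R x y : Prop :=
  exists p i, x = pair p i /\ exists q j, y = pair q j /\
    ((i = j /\ (p = q \/ pair p q ∈ R)) \/
     (i = 1 /\ j = 0 /\ rel_lt leP p q) \/
     (i = 0 /\ j = 1 /\ ~ rel_lt leP q p)).

Lemma endpoint_le_iff leP R p i q j : endpoint_le leP R (pair p i) (pair q j) <->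
  (i = j /\ (p = q \/ pair p q ∈ R)) \/
  (i = 1 /\ j = 0 /\ rel_lt leP p q) \/
  (i = 0 /\ j = 1 /\ ~ rel_lt leP q p).
Proof.
  split.
  - intros (p' & i' & E & q' & j' & E' & H).
    now apply pair_inj in E as [-> ->], E' as [-> ->].
  - intros H. exists p, i. split; [reflexivity|]. now exists q, j.
Qed.

Lemma endpoint_le_same leP R p i q :
  endpoint_le leP R (pair p i) (pair q i) <-> p = q \/ pair p q ∈ R.
Proof.
  rewrite endpoint_le_iff. pose proof (@zero_neq_one M HM).
  split; [|tauto]. intros [[_ H'] | [[? []] | [? []]]]; try congruence; exact H'.
Qed.

Lemma endpoint_le_rl leP R p q :
  endpoint_le leP R (pair p 1) (pair q 0) <-> rel_lt leP p q.
Proof.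
  rewrite endpoint_le_iff. pose proof (@zero_neq_one M HM).
  split; [|tauto]. intros [[? H'] | [(_ & _ & H') | [? []]]]; try congruence; exact H'.
Qed.

Lemma endpoint_le_lr leP R p q :
  endpoint_le leP R (pair p 0) (pair q 1) <-> ~ rel_lt leP q p.
Proof.
  rewrite endpoint_le_iff. pose proof (@zero_neq_one M HM).
  split; [|tauto]. intros [[? H'] | [[? []] | (_ & _ & H')]]; try congruence; exact H'.
Qed.

Lemma endpoint_order P leP R : partial_order P leP -> compatible_order P leP R ->
  exists L leL, linear_order L leL /\
    (forall x, x ∈ L <-> exists p i, x = pair p i /\ (p ∈ P /\ (i = 0 \/ i = 1))) /\
    forall x y, x ∈ L -> y ∈ L -> (rel_le leL x y <-> endpoint_le leP R x y).
Proof.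
  intros HP C.
  pose (D := fun x => exists p i, x = pair p i /\ (p ∈ P /\ (i = 0 \/ i = 1))).
  assert (HT : forall p q r i j k, p ∈ P -> q ∈ P -> r ∈ P ->
      i = 0 \/ i = 1 -> j = 0 \/ j = 1 -> k = 0 \/ k = 1 ->
      endpoint_le leP R (pair p i) (pair q j) -> endpoint_le leP R (pair q j) (pair r k) ->
      endpoint_le leP R (pair p i) (pair r k)).
  { assert (Hsame : forall p q r, p ∈ P -> q ∈ P -> r ∈ P -> p = q \/ pair p q ∈ R ->
        q = r \/ pair q r ∈ R -> p = r \/ pair p r ∈ R).
    { intros p q r Hp Hq Hr [-> | H] [-> | H']; auto. right.
      now apply (compat_trans _ _ _ C p q r). }
    assert (Hl : forall p q r, p ∈ P -> q ∈ P -> r ∈ P ->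
        rel_lt leP p q -> q = r \/ pair q r ∈ R -> rel_lt leP p r).
    { intros p q r Hp Hq Hr H [-> | H']; [exact H|]. now apply (compat_l _ _ _ C p q r). }
    assert (Hr : forall p q r, p ∈ P -> q ∈ P -> r ∈ P ->
        p = q \/ pair p q ∈ R -> rel_lt leP q r -> rel_lt leP p r).
    { intros p q r Hp Hq Hr' [-> | H] H'; [exact H'|]. now apply (compat_r _ _ _ C p q r). }
    intros p q r i j k Pp Pq Pr [-> | ->] [-> | ->] [-> | ->];
      rewrite ?endpoint_le_same, ?endpoint_le_rl, ?endpoint_le_lr; intros H1 H2.
    - eauto.
    - intros H. apply H2. eauto.
    (* Left, right, left: were [r] before [p], then [rel_lt leP q r] would give [rel_lt leP q p] by
       [compat_l]. The case right, left, right is the mirror image, by [compat_r]. *)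
    - destruct (compat_dec _ _ _ p r C Pp Pr) as [H|H]; [exact H|].
      exfalso. apply H1. eauto.
    - intros H. apply H1. eauto.
    - eauto.
    - destruct (compat_dec _ _ _ p r C Pp Pr) as [H|H]; [exact H|].
      exfalso. apply H2. eauto.
    - eauto.
    - eauto. }
  destruct (linear_order_exists D (endpoint_le leP R)) as (L & leL & HL & EL & Ele).
  - unfold D. definable.
  - unfold endpoint_le. definable.
  - intros x (p & i & -> & Hp & Hi). apply endpoint_le_same. auto.
  - intros x y z (p & i & -> & Hp & Hi) (q & j & -> & Hq & Hj) (r & k & -> & Hr & Hk).
    apply HT; auto.
  - intros x y (p & i & -> & Hp & Hi) (q & j & -> & Hq & Hj).
    destruct Hi as [-> | ->], Hj as [-> | ->];
      rewrite ?endpoint_le_same, ?endpoint_le_rl, ?endpoint_le_lr; try tauto.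
    all: intros [-> | H] [H' | H']; try congruence.
    all: destruct (compat_asym _ _ _ _ _ C Hp Hq H H').
  - intros x y (p & i & -> & Hp & Hi) (q & j & -> & Hq & Hj).
    destruct Hi as [-> | ->], Hj as [-> | ->];
      rewrite ?endpoint_le_same, ?endpoint_le_rl, ?endpoint_le_lr;
      try (destruct (classic (rel_lt leP q p)); destruct (classic (rel_lt leP p q)); tauto).
    all: destruct (compat_dec _ _ _ p q C Hp Hq); tauto.
  - exists L, leL. split; [exact HL|]. split; [exact EL|].
    intros x y Hx Hy. rewrite Ele. apply EL in Hx, Hy. tauto.
Qed.

Lemma compatible_proper_closed P leP R : partial_order P leP ->
  compatible_order P leP R -> proper_closed_interval_order P leP.
Proof.
  intros HP C. destruct (endpoint_order P leP R HP C) as (L & leL & HL & EL & Ele).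
  assert (HL0 : forall p, p ∈ P -> pair p 0 ∈ L) by (intros; apply EL; eauto 6).
  assert (HL1 : forall p, p ∈ P -> pair p 1 ∈ L) by (intros; apply EL; eauto 6).
  destruct (function_exists P L (fun p x => x = pair p 0)) as (f0 & F0 & E0).
  { definable. }
  { intros p _. exists (pair p 0). split; auto. }
  { intros p x Hp ->. auto. }
  destruct (function_exists P L (fun p x => x = pair p 1)) as (f1 & F1 & E1).
  { definable. }
  { intros p _. exists (pair p 1). split; auto. }
  { intros p x Hp ->. auto. }
  assert (Hlt : forall p q i, (i = 0 \/ i = 1) -> p ∈ P -> q ∈ P ->
      (rel_lt leL (pair p i) (pair q i) <-> pair p q ∈ R)).
  { intros p q i Hi Hp Hq. unfold rel_lt.
    rewrite Ele by (destruct Hi as [-> | ->]; auto). rewrite endpoint_le_same. split.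
    - intros [[-> | H] N]; tauto.
    - intros H. split; [auto|]. intros E. apply pair_inj in E as [-> _].
      now apply (compat_irrefl _ _ _ C q). }
  exists L, leL, f0, f1. split; [exact HL|]. split; [exact F0|]. split; [exact F1|].
  split; [|split].
  - intros p x y Hp Hx Hy. apply E0 in Hx as [_ ->]. apply E1 in Hy as [_ ->].
    apply Ele; auto. apply endpoint_le_lr, rel_lt_irrefl.
  - intros p q x y Hp Hq Hx Hy. apply E1 in Hx as [_ ->]. apply E0 in Hy as [_ ->].
    unfold rel_lt at 2. rewrite Ele by auto. rewrite endpoint_le_rl.
    split; [|tauto]. intros H. split; [exact H|].
    intros E. apply pair_inj in E as [_ E]. symmetry in E. now apply zero_neq_one in E.
  - intros p q x0 y0 x1 y1 Hp Hq H1 H2 H3 H4.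
    apply E0 in H1 as [_ ->], H2 as [_ ->]. apply E1 in H3 as [_ ->], H4 as [_ ->].
    rewrite !Hlt by auto. tauto.
Qed.

Lemma compatible_proper_1_1 P leP R : partial_order P leP ->
  compatible_order P leP R -> proper_1_1_interval_order P leP.
Proof.
  intros HP C. destruct (endpoint_order P leP R HP C) as (L & leL & HL & EL & Ele).
  assert (HL0 : forall p, p ∈ P -> pair p 0 ∈ L) by (intros; apply EL; eauto 6).
  assert (HL1 : forall p, p ∈ P -> pair p 1 ∈ L) by (intros; apply EL; eauto 6).
  destruct (rel_comprehension (fun p x => p ∈ P /\ x ∈ L /\
    rel_le leL (pair p 0) x /\ rel_le leL x (pair p 1))) as (F & EF & SF); [definable|].
  destruct HL as [HPL TL]. pose proof HPL as (_ & RL & TrL & AL).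
  assert (H01 : forall p, p ∈ P -> rel_le leL (pair p 0) (pair p 1)).
  { intros p Hp. apply Ele; auto. apply endpoint_le_lr, rel_lt_irrefl. }
  assert (HF0 : forall p, p ∈ P -> fiber F p (pair p 0)) by (intros; apply EF; auto 8).
  assert (HF1 : forall p, p ∈ P -> fiber F p (pair p 1)).
  { intros p Hp. apply EF; auto 8. }
  (* If one closed interval is contained in another, the left endpoints put [q] weakly before [p]
     and the right endpoints put [p] weakly before [q]. This yields (i3) and (i4) together. *)
  assert (Hinj : forall p q, p ∈ P -> q ∈ P ->
      (forall x, fiber F p x -> fiber F q x) -> p = q).
  { intros p q Hp Hq H.
    pose proof (H _ (HF0 p Hp)) as H0. pose proof (H _ (HF1 p Hp)) as H1.
    apply EF in H0 as (_ & _ & H0 & _), H1 as (_ & _ & _ & H1).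
    apply Ele in H0; auto. apply Ele in H1; auto.
    rewrite endpoint_le_same in H0, H1.
    destruct H0 as [H0 | H0], H1 as [H1 | H1]; try congruence.
    destruct (compat_asym _ _ _ _ _ C Hp Hq H1 H0). }
  exists L, leL, F. split; [now split|]. split; [|split; [|split; [|split]]].
  - intros z Hz. destruct (SF z Hz) as (p & x & ->). apply EF in Hz.
    exists p, x. tauto.
  - intros p Hp. split; [exists (pair p 0); auto|].
    intros x y z Hx Hz Hy Hxy Hyz. apply EF in Hx, Hz. apply EF.
    split; [exact Hp|]. split; [exact Hy|].
    split; [apply (TrL _ x) | apply (TrL _ z)]; tauto.
  - intros p q Hp Hq. split.
    + intros H x y Hx Hy. apply EF in Hx as (_ & _ & _ & Hx), Hy as (_ & _ & Hy & _).
      apply (rel_le_lt_trans L leL x (pair p 1)); [exact HPL | exact Hx|].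
      apply (rel_lt_le_trans L leL _ (pair q 0)); [exact HPL | | exact Hy].
      split; [apply Ele; auto; now apply endpoint_le_rl|].
      intros E. apply pair_inj in E as [_ E]. symmetry in E. now apply zero_neq_one in E.
    + intros H. destruct (H _ _ (HF1 p Hp) (HF0 q Hq)) as [H' _].
      apply Ele in H'; auto. now apply endpoint_le_rl in H'.
  - intros p q Hp Hq N H. apply N, Hinj; auto. intros x. apply H.
  - intros p q Hp Hq H x. now rewrite (Hinj p q Hp Hq H).
Qed.

Lemma function_value (A B : num M -> Prop) f p : is_function A B f -> A p ->
  exists x, maps_to f p x /\ B x.
Proof.
  intros [S H] Hp. destruct (H p Hp) as (x & Hx & _). exists x. split; [exact Hx|].
  destruct (S _ Hx) as (p' & x' & _ & Hx' & E). now apply pair_inj in E as [_ ->].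
Qed.

Lemma function_unique (A B : num M -> Prop) f p x y : is_function A B f -> A p ->
  maps_to f p x -> maps_to f p y -> x = y.
Proof.
  intros [_ H] Hp Hx Hy. destruct (H p Hp) as (z & _ & U).
  now rewrite <- (U x Hx), <- (U y Hy).
Qed.

(** Left endpoints order the elements, ties being broken by number. Condition (c5) carries the weak
    comparison over to the right endpoints, as [compat_r] requires. *)
Lemma proper_closed_compatible P leP :
  proper_closed_interval_order P leP -> exists R, compatible_order P leP R.
Proof.
  intros (L & leL & f0 & f1 & HL & F0 & F1 & c1 & c2 & c5).
  pose (before := fun p q => p ∈ P /\ q ∈ P /\ exists x y, maps_to f0 p x /\
    maps_to f0 q y /\ (rel_lt leL x y \/ (x = y /\ p < q))).
  assert (Hb : forall p q x y, p ∈ P -> q ∈ P -> maps_to f0 p x -> maps_to f0 q y ->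
      (before p q <-> rel_lt leL x y \/ (x = y /\ p < q))).
  { intros p q x y Hp Hq Hx Hy. split.
    - intros (_ & _ & x' & y' & Hx' & Hy' & H).
      now rewrite (function_unique _ _ _ _ _ _ F0 Hp Hx Hx'),
        (function_unique _ _ _ _ _ _ F0 Hq Hy Hy').
    - intros H. split; [exact Hp|]. split; [exact Hq|]. now exists x, y. }
  (* Endpoints exist and are unique on [P], so the complement of [before] can also be expressed by
     exhibiting them, and the relation is Delta^0_1. *)
  destruct (rel_comprehension before) as (R & ER & _).
  { split; [unfold before; definable|].
    apply (Sigma1_ext (fun e => ~ e 1%nat ∈ P \/ ~ e 0%nat ∈ P \/
      exists x y, maps_to f0 (e 1%nat) x /\ maps_to f0 (e 0%nat) y /\
        ~ (rel_lt leL x y \/ (x = y /\ e 1%nat < e 0%nat)))); [|definable].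
    intros e. split.
    - intros [H | [H | (x & y & Hx & Hy & H)]] B; try (now apply H, B).
      pose proof B as (Hp & Hq & _). now apply H, (Hb _ _ _ _ Hp Hq Hx Hy).
    - intros H. destruct (classic (e 1%nat ∈ P)) as [Hp|]; [right|now left].
      destruct (classic (e 0%nat ∈ P)) as [Hq|]; [right|now left].
      destruct (function_value _ _ _ _ F0 Hp) as (x & Hx & _).
      destruct (function_value _ _ _ _ F0 Hq) as (y & Hy & _).
      exists x, y. split; [exact Hx|]. split; [exact Hy|].
      rewrite <- (Hb _ _ _ _ Hp Hq Hx Hy). exact H. }
  pose proof HL as [HPL TL]. pose proof HPL as (_ & RL & TrL & AL).
  assert (Hval : forall p, p ∈ P -> exists x y, maps_to f0 p x /\ maps_to f1 p y /\
      x ∈ L /\ y ∈ L).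
  { intros p Hp. destruct (function_value _ _ _ _ F0 Hp) as (x & Hx & Lx).
    destruct (function_value _ _ _ _ F1 Hp) as (y & Hy & Ly). now exists x, y. }
  assert (Hle : forall p q x0 x1 y0 y1, p ∈ P -> q ∈ P ->
      maps_to f0 p x0 -> maps_to f1 p x1 -> maps_to f0 q y0 -> maps_to f1 q y1 ->
      pair p q ∈ R -> rel_le leL x0 y0 /\ rel_le leL x1 y1).
  { intros p q x0 x1 y0 y1 Hp Hq Hx0 Hx1 Hy0 Hy1 H.
    destruct (Hval p Hp) as (x0' & x1' & A0 & A1 & Lx0 & Lx1).
    rewrite (function_unique _ _ _ _ _ _ F0 Hp A0 Hx0) in Lx0.
    rewrite (function_unique _ _ _ _ _ _ F1 Hp A1 Hx1) in Lx1.
    destruct (Hval q Hq) as (y0' & y1' & B0 & B1 & Ly0 & Ly1).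
    rewrite (function_unique _ _ _ _ _ _ F0 Hq B0 Hy0) in Ly0.
    rewrite (function_unique _ _ _ _ _ _ F1 Hq B1 Hy1) in Ly1.
    assert (H0 : rel_le leL x0 y0).
    { apply ER, (Hb p q x0 y0) in H; auto.
      destruct H as [[H _] | [-> _]]; auto. }
    split; [exact H0|]. apply NNPP. intros N.
    apply (linear_not_le L) in N; auto.
    apply (c5 q p y0 x0 y1 x1) in N as [N N']; auto. }
  exists R. constructor.
  - intros p Hp H. destruct (Hval p Hp) as (x & _ & Hx & _).
    apply ER, (Hb p p x x) in H; auto. destruct H as [H | [_ H]].
    + now apply rel_lt_irrefl in H.
    + now apply lt_irrefl in H.
  - intros p q r Hp Hq Hr H1 H2.
    destruct (Hval p Hp) as (x & _ & Hx & _), (Hval q Hq) as (y & _ & Hy & _),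
      (Hval r Hr) as (z & _ & Hz & _).
    apply ER, (Hb p q x y) in H1; auto. apply ER, (Hb q r y z) in H2; auto.
    apply ER, (Hb p r x z); auto.
    destruct H1 as [H1 | [-> H1]], H2 as [H2 | [E H2]]; try subst z.
    + left. now apply (rel_lt_trans L leL x y z).
    + auto.
    + auto.
    + right. split; [reflexivity|]. now apply (lt_trans p q r).
  - intros p q Hp Hq N.
    destruct (Hval p Hp) as (x & _ & Hx & _ & Lx & _),
      (Hval q Hq) as (y & _ & Hy & _ & Ly & _).
    rewrite !ER, (Hb p q x y), (Hb q p y x) by auto.
    destruct (classic (x = y)) as [-> | Nx].
    + destruct (trichotomy p q) as [H | [H | H]]; tauto.
    + destruct (TL x y Lx Ly) as [H | H]; [left | right]; left; split; auto.
  - intros p q r Hp Hq Hr H1 H2.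
    destruct (Hval p Hp) as (x0 & x1 & Hx0 & Hx1 & _),
      (Hval q Hq) as (y0 & y1 & Hy0 & Hy1 & _),
      (Hval r Hr) as (z0 & z1 & Hz0 & Hz1 & _).
    apply (c2 p q x1 y0) in H1; auto. apply (c2 p r x1 z0); auto.
    apply (rel_lt_le_trans L leL _ _ _ HPL H1).
    now apply (Hle q r y0 y1 z0 z1).
  - intros p q r Hp Hq Hr H1 H2.
    destruct (Hval p Hp) as (x0 & x1 & Hx0 & Hx1 & _),
      (Hval q Hq) as (y0 & y1 & Hy0 & Hy1 & _),
      (Hval r Hr) as (z0 & z1 & Hz0 & Hz1 & _).
    apply (c2 q r y1 z0) in H2; auto. apply (c2 p r x1 z0); auto.
    apply (rel_le_lt_trans L leL x1 y1); auto.
    now apply (Hle p q x0 x1 y0 y1).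
Qed.

(** * Consequences of an interval representation *)

Section IntervalRepresentation.

Context {P leP L leL F : set M} (HL : linear_order L leL)
  (HF : sub_prod (mem P) (mem L) F) (i1 : cond_i1 P L leL F)
  (i2 : cond_i2 P leP leL F) (i4 : cond_i4 P F).

Lemma fiber_dom p x : fiber F p x -> x ∈ L.
Proof.
  intros H. destruct (HF _ H) as (p' & x' & _ & Hx & E).
  now apply pair_inj in E as [_ ->].
Qed.

Lemma not_rel_lt p q : p ∈ P -> q ∈ P -> ~ rel_lt leP p q ->
  exists x y, fiber F p x /\ fiber F q y /\ rel_le leL y x.
Proof.
  intros Hp Hq N. apply NNPP. intros H. apply N, i2; auto. intros x y Hx Hy.
  apply (linear_not_le L); eauto using fiber_dom. intros C. apply H. now exists x, y.
Qed.

Lemma interval_no_2_plus_2 : partial_order P leP -> no_2_plus_2 leP.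
Proof.
  intros HP p0 q0 p1 q1 H0 H1. apply NNPP. intros N. pose proof HL as [HPL _].
  destruct (partial_order_dom _ _ _ _ HP (proj1 H0)) as [Hp0 Hq0].
  destruct (partial_order_dom _ _ _ _ HP (proj1 H1)) as [Hp1 Hq1].
  destruct (not_rel_lt p0 q1) as (x & y & Hx & Hy & L1); auto.
  { intros [H _]. auto. }
  destruct (not_rel_lt p1 q0) as (x' & y' & Hx' & Hy' & L2); auto.
  { intros [H _]. auto. }
  apply (rel_lt_irrefl leL x). apply (rel_lt_le_trans L leL x y x HPL); [|exact L1].
  apply (rel_lt_trans L leL x y' y HPL); [now apply (i2 p0 q0)|].
  apply (rel_le_lt_trans L leL y' x' y HPL); [exact L2|]. now apply (i2 p1 q1).
Qed.

(** In a 3+1 pattern [q] would reach back to a point of [p0] and forward to a point of [p2]. By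
    convexity it contains the interval of [p1], by (i4) it equals that interval, and then it lies
    entirely before [p2]. *)
Lemma interval_no_3_plus_1 : partial_order P leP -> no_3_plus_1 P leP.
Proof.
  intros HP p0 p1 p2 q Hq H0 H1. apply NNPP. intros N. pose proof HL as [HPL _].
  destruct (partial_order_dom _ _ _ _ HP (proj1 H0)) as [Hp0 Hp1].
  destruct (partial_order_dom _ _ _ _ HP (proj1 H1)) as [_ Hp2].
  destruct (not_rel_lt p0 q) as (x & y & Hx & Hy & L1); auto.
  { intros [H _]. auto. }
  destruct (not_rel_lt q p2) as (x' & y' & Hx' & Hy' & L2); auto.
  { intros [H _]. auto. }
  assert (K : forall z, fiber F p1 z -> fiber F q z).
  { intros z Hz. destruct (i1 q Hq) as [_ Cq].
    apply (Cq y z x'); eauto using fiber_dom.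
    - apply (rel_le_lt_trans L leL y x z HPL); [exact L1|]. now apply (i2 p0 p1).
    - apply (rel_lt_le_trans L leL z y' x' HPL); [|exact L2]. now apply (i2 p1 p2). }
  apply (rel_lt_irrefl leL y'). apply (rel_le_lt_trans L leL y' x' y' HPL L2).
  apply (i2 p1 p2); auto. now apply (i4 p1 q).
Qed.

Context (i3 : cond_i3 P F).

Lemma fiber_difference p q : p ∈ P -> q ∈ P -> p <> q ->
  exists x, fiber F p x /\ ~ fiber F q x.
Proof.
  intros Hp Hq N. apply NNPP. intros H. apply (i3 p q Hp Hq N), (i4 p q Hp Hq).
  intros x Hx. apply NNPP. intros Nx. apply H. now exists x.
Qed.

(** Naming the second point [y] avoids a universal quantifier and makes the relation Sigma^0_1. For
    distinct elements its complement is its converse, so it is even Delta^0_1. *)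
Definition left_of p q : Prop := p ∈ P /\ q ∈ P /\
  exists x y, fiber F p x /\ ~ fiber F q x /\ fiber F q y /\ rel_lt leL x y.

Lemma left_of_iff p q : left_of p q <-> p ∈ P /\ q ∈ P /\
  exists x, fiber F p x /\ forall y, fiber F q y -> rel_lt leL x y.
Proof.
  split; intros (Hp & Hq & H); (split; [exact Hp|]; split; [exact Hq|]).
  - destruct H as (x & y & Hx & Nx & Hy & [Hxy _]). exists x. split; [exact Hx|].
    intros z Hz. apply (linear_not_le L); eauto using fiber_dom.
    intros Hzx. apply Nx. destruct (i1 q Hq) as [_ Cq].
    apply (Cq z x y); eauto using fiber_dom.
  - destruct H as (x & Hx & H). destruct (i1 q Hq) as [[y Hy] _]. exists x, y.
    split; [exact Hx|]. split; [|auto]. intros N. now apply (rel_lt_irrefl leL x), H.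
Qed.

Lemma left_of_asym p q : left_of p q -> left_of q p -> False.
Proof.
  rewrite !left_of_iff. intros (_ & _ & x & Hx & H) (_ & _ & y & Hy & H').
  apply (rel_lt_irrefl leL x). apply (rel_lt_trans L leL x y x (proj1 HL)); auto.
Qed.

Lemma left_of_total p q : p ∈ P -> q ∈ P -> p <> q -> left_of p q \/ left_of q p.
Proof.
  intros Hp Hq N. destruct (fiber_difference p q Hp Hq N) as (x & Hx & Nx).
  destruct (fiber_difference q p) as (y & Hy & Ny); auto.
  destruct (proj2 HL x y) as [H | H]; eauto using fiber_dom; [left | right];
    (split; [|split]); auto; [exists x, y | exists y, x]; repeat (split; [assumption|]);
    intros E; subst; contradiction.
Qed.

Lemma interval_1_1_compatible : exists R, compatible_order P leP R.
Proof.
  destruct (rel_comprehension left_of) as (R & ER & _).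
  { split; [unfold left_of; definable|].
    apply (Sigma1_ext (fun e => ~ e 1%nat ∈ P \/ ~ e 0%nat ∈ P \/
      e 1%nat = e 0%nat \/ left_of (e 0%nat) (e 1%nat))); [|unfold left_of; definable].
    intros e. split.
    - intros [H | [H | [H | H]]] B; try (now apply H, B).
      + rewrite H in B. exact (left_of_asym _ _ B B).
      + exact (left_of_asym _ _ B H).
    - intros H. destruct (classic (e 1%nat ∈ P)) as [Hp|]; [right|now left].
      destruct (classic (e 0%nat ∈ P)) as [Hq|]; [right|now left].
      destruct (classic (e 1%nat = e 0%nat)) as [|N]; [now left | right].
      destruct (left_of_total _ _ Hp Hq N); tauto. }
  pose proof HL as [HPL _].
  exists R. constructor; intros *.
  - intros _ H. apply ER in H. exact (left_of_asym _ _ H H).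
  - rewrite !ER, !left_of_iff.
    intros _ _ _ (Hp & Hq & x & Hx & H) (_ & Hr & y & Hy & H').
    split; [exact Hp|]. split; [exact Hr|]. exists x. split; [exact Hx|].
    intros z Hz. apply (rel_lt_trans L leL x y z HPL); auto.
  - intros Hp Hq N. rewrite !ER. now apply left_of_total.
  - rewrite !ER, !left_of_iff. intros Hp Hq Hr H1 (_ & _ & y & Hy & H).
    apply i2; auto. intros x z Hx Hz.
    apply (rel_lt_trans L leL x y z HPL); [now apply (i2 p q) | auto].
  (* If [p] had a point [u] at or beyond a point [v] of [r], then a point [y] of [q] outside [p]
     would lie between [u] and a point [x] of [p] left of all of [q], against convexity. *)
  - rewrite !ER. intros Hp Hq Hr Hl H2. apply NNPP. intros N.
    destruct (not_rel_lt p r Hp Hr N) as (u & v & Hu & Hv & Huv).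
    assert (Npq : q <> p) by (intros ->; exact (left_of_asym _ _ Hl Hl)).
    destruct (fiber_difference q p Hq Hp Npq) as (y & Hy & Ny). apply Ny.
    apply left_of_iff in Hl as (_ & _ & x & Hx & H).
    destruct (i1 p Hp) as [_ Cp]. apply (Cp x y u); eauto using fiber_dom.
    + now apply H.
    + apply (rel_lt_le_trans L leL y v u HPL); [now apply (i2 q r) | exact Huv].
Qed.

End IntervalRepresentation.

End CompatibleOrders.

(** * Compatible orders from Weak König's Lemma *)

Section Compactness.

Context {M : L2_structure} {HM : RCA0 M} {P leP : set M}.
Context (HP : partial_order P leP) (H22 : no_2_plus_2 leP) (H31 : no_3_plus_1 P leP).
Implicit Types (p q r l : num M).

(** An element below [l] witnesses that every compatible order puts [p] before [q]. *)
Definition forced l p q : Prop := exists r, r < l /\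
  ((rel_lt leP r q /\ ~ rel_lt leP r p) \/ (rel_lt leP p r /\ ~ rel_lt leP q r)).

(** Two witnesses of the same kind form a 2+2 with [p] and [q]. Witnesses of different kinds form a
    chain of three with [p] or [q] in the middle, and the other one of the two completes a 3+1. *)
Lemma forced_asym l p q : p ∈ P -> q ∈ P -> forced l p q -> forced l q p -> False.
Proof.
  assert (E : forall a b, rel_le leP a b -> ~ rel_lt leP a b -> a = b).
  { intros a b H N. apply NNPP. intros D. now apply N. }
  assert (T : forall a b c, rel_lt leP a b -> rel_lt leP b c -> rel_lt leP a c).
  { intros a b c. now apply (rel_lt_trans P). }
  intros Hp Hq (r & _ & [[H N] | [H N]]) (r' & _ & [[H' N'] | [H' N']]).
  - destruct (H22 r q r' p H H') as [C | C]; apply E in C; auto; subst; eauto.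
  - destruct (H31 r q r' p Hp H H') as [C | C]; [|apply E in C; auto; subst; eauto].
    apply E in C; auto; subst; eauto.
  - destruct (H31 r' p r q Hq H' H) as [C | C]; apply E in C; auto; subst; eauto.
  - destruct (H22 p r q r' H H') as [C | C]; apply E in C; auto; subst; eauto.
Qed.

Definition before l p q : Prop := forced l p q \/ (~ forced l q p /\ p < q).

Lemma not_forced_l l p q r : ~ forced l q p -> r < l ->
  rel_lt leP r p -> rel_lt leP r q.
Proof.
  intros H Hr H'. apply NNPP. intros N. apply H. exists r. split; [exact Hr|]. now left.
Qed.

Lemma not_forced_r l p q r : ~ forced l q p -> r < l ->
  rel_lt leP q r -> rel_lt leP p r.
Proof.
  intros H Hr H'. apply NNPP. intros N. apply H. exists r. split; [exact Hr|]. now right.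
Qed.

(** [~ forced l q p] says that, among elements below [l], those under [p] are under [q] and those
    over [q] are over [p]. Such inclusions compose, so this is a preorder, of which [before] is a
    linear refinement. *)
Lemma not_forced_trans l p q r : ~ forced l q p -> ~ forced l r q -> ~ forced l r p.
Proof.
  intros H H' (x & Hx & [[L N] | [L N]]); apply N.
  - eauto using not_forced_l.
  - eauto using not_forced_r.
Qed.

Lemma before_not_forced l p q : p ∈ P -> q ∈ P -> before l p q -> ~ forced l q p.
Proof. intros Hp Hq [H | [H _]]; [|exact H]. intros H'. now apply (forced_asym l p q). Qed.

Lemma before_trans l p q r : p ∈ P -> q ∈ P -> r ∈ P ->
  before l p q -> before l q r -> before l p r.
Proof.
  intros Hp Hq Hr H1 H2.
  pose proof (before_not_forced _ _ _ Hp Hq H1) as N1.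
  pose proof (before_not_forced _ _ _ Hq Hr H2) as N2.
  pose proof (not_forced_trans _ _ _ _ N1 N2) as N3.
  destruct (classic (forced l p r)) as [F | F]; [now left|]. right.
  split; [exact N3|].
  (* Here [p] and [r] are tied, so a forced step would contradict transitivity of the preorder. Both
     steps are therefore ties, decided by number. *)
  destruct H1 as [H1 | [_ H1]]; [now destruct (not_forced_trans _ _ _ _ N2 F)|].
  destruct H2 as [H2 | [_ H2]]; [now destruct (not_forced_trans _ _ _ _ F N1)|].
  now apply (lt_trans p q r).
Qed.

(** Finite approximation of [compatible_order]: [I] and [O] are the sets of pairs
    decided to belong and not to belong to the relation. *)
Definition consistent (I O : num M -> num M -> Prop) p q r : Prop :=
  p ∈ P -> q ∈ P -> r ∈ P ->
  ~ I p p /\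
  ~ (p <> q /\ O p q /\ O q p) /\
  ~ (I p q /\ I q r /\ O p r) /\
  ~ (rel_lt leP p q /\ I q r /\ ~ rel_lt leP p r) /\
  ~ (I p q /\ rel_lt leP q r /\ ~ rel_lt leP p r).

(** Each clause only forbids a combination of decisions, so making fewer decisions preserves
    consistency. *)
Lemma consistent_mono (I O I' O' : num M -> num M -> Prop) n p q r :
  le p n -> le q n -> le r n ->
  (forall a b, le a n -> le b n -> I a b -> I' a b) ->
  (forall a b, le a n -> le b n -> O a b -> O' a b) ->
  consistent I' O' p q r -> consistent I O p q r.
Proof.
  intros Hp Hq Hr HI HO C Pp Pq Pr.
  destruct (C Pp Pq Pr) as (C1 & C2 & C3 & C4 & C5).
  split; [|split; [|split; [|split]]].
  - eauto.
  - intros (D & H1 & H2). apply C2. auto.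
  - intros (H1 & H2 & H3). apply C3. auto.
  - intros (H1 & H2 & H3). apply C4. auto.
  - intros (H1 & H2 & H3). apply C5. auto.
Qed.

(** Truncating the witnesses at [l] does no harm, because the clauses about the order of [P] use [p]
    and [r] themselves as witnesses. *)
Lemma before_consistent l p q r : p < l -> q < l -> r < l ->
  consistent (before l) (fun a b => ~ before l a b) p q r.
Proof.
  intros Lp Lq Lr Hp Hq Hr. split; [|split; [|split; [|split]]].
  - intros [(x & _ & H) | [_ H]]; [tauto | now apply lt_irrefl in H].
  - intros (D & H1 & H2). unfold before in H1, H2.
    destruct (trichotomy p q) as [L | [L | L]]; [tauto | contradiction | tauto].
  - intros (H1 & H2 & H3). apply H3. now apply (before_trans l p q r).
  - intros (H1 & H2 & H3). apply H3.
    apply (not_forced_l l q r p); auto. now apply before_not_forced.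
  - intros (H1 & H2 & H3). apply H3.
    apply (not_forced_r l p q r); auto. now apply before_not_forced.
Qed.

Lemma WKL_compatible : weak_Konig_lemma M -> exists R, compatible_order P leP R.
Proof.
  intros WKL.
  (* A node is a partial characteristic function: its entry at [pair a b] decides whether [a] comes
     before [b]. Pairs beyond its length are undecided, which is why positive and negative decisions
     are kept apart. *)
  destruct (comprehension (fun s => binary_seq s /\ exists l, l < s + 1 /\
    (seq_length s l /\ forall p, p < l -> forall q, q < l -> forall r, r < l ->
      consistent (fun a b => seq_entry s (pair a b) 1)
        (fun a b => seq_entry s (pair a b) 0) p q r))) as [T HT].
  { unfold consistent. definable. }
  destruct (WKL T) as [f [Ff Pf]].
  - split; [intros s Hs; now apply HT in Hs|].
    intros s t Ht Fs Hst. apply HT in Ht as (Bt & l & _ & Lt & C).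
    pose proof Fs as (_ & _ & _ & k & Ls). apply HT.
    split; [split; [exact Fs|]; intros i j H; apply (proj2 Bt i), Hst, H|].
    assert (K : forall i, i < k -> i < l).
    { intros i Hi. apply Ls in Hi as [j Hj]. apply Lt. exists j. now apply Hst. }
    exists k. split; [now apply lt_succ_le, seq_length_le|]. split; [exact Ls|].
    intros p Hp q Hq r Hr.
    apply (consistent_mono _ _ (fun a b => seq_entry t (pair a b) 1)
        (fun a b => seq_entry t (pair a b) 0) l); auto using lt_le.
  - intros [k Hk].
    (* The node of length [k] read off from [before k] lies in the tree, and its code is at least
       [k], against the assumed bound. *)
    destruct (binary_seq_exists k (fun z => exists p q, z = pair p q /\ before k p q))
      as (s & Bs & Ls & Hs); [unfold before, forced; definable|].
    assert (Ts : s ∈ T).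
    { apply HT. split; [exact Bs|]. exists k.
      split; [now apply lt_succ_le, seq_length_le|]. split; [exact Ls|].
      intros p Hp q Hq r Hr.
      assert (Hs' : forall a b, pair a b < k ->
          (seq_entry s (pair a b) 1 <-> before k a b)).
      { intros a b Hab. rewrite Hs by exact Hab. split; [|now exists a, b].
        intros (a' & b' & E & H). now apply pair_inj in E as [-> ->]. }
      assert (D : forall i j, seq_entry s i j -> i < k).
      { intros i j H. apply Ls. now exists j. }
      apply (consistent_mono _ _ (before k) (fun a b => ~ before k a b) k);
        auto using lt_le, before_consistent.
      - intros a b _ _ H. apply Hs'; eauto.
      - intros a b _ _ H H'. apply Hs' in H'; [|eauto].
        now apply (binary_entry_unique s (pair a b)). }
    apply (lt_not_le s k); [now apply Hk | now apply seq_length_le].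
  - destruct (rel_comprehension (fun p q => maps_to f (pair p q) 1)) as (R & ER & _);
      [definable|].
    assert (C : forall p q r, consistent (fun a b => maps_to f (pair a b) 1)
        (fun a b => maps_to f (pair a b) 0) p q r).
    { intros p q r. pose (n := p + q + r).
      assert (Lp : le p n) by (apply (le_trans _ (p + q)); apply le_add_r).
      assert (Lq : le q n) by (apply (le_trans _ (p + q)); [apply le_add_l | apply le_add_r]).
      assert (Lr : le r n) by apply le_add_l.
      (* This length reaches the entry of every pair of numbers up to [n]. *)
      destruct (Pf (pair n n + 1)) as (s & Ts & _ & Ls & Hs).
      apply HT in Ts as (Bs & l & _ & Ls' & C).
      rewrite (seq_length_unique _ _ _ Ls' Ls) in C.
      assert (Hn : forall a, le a n -> a < pair n n + 1).
      { intros a Ha. apply lt_succ_le, (le_trans _ _ _ Ha), le_pair_l. }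
      apply (consistent_mono _ _ (fun a b => seq_entry s (pair a b) 1)
        (fun a b => seq_entry s (pair a b) 0) n); auto.
      all: intros a b Ha Hb H; apply Hs; [apply lt_succ_le; now apply pair_le | exact H]. }
    exists R. constructor; intros *.
    + intros Hp H. apply ER in H. exact (proj1 (C p p p Hp Hp Hp) H).
    + rewrite !ER. intros Hp Hq Hr H1 H2.
      destruct (function_value _ _ _ (pair p r) Ff I) as (y & Hy & [-> | ->]); [|exact Hy].
      now destruct (C p q r) as (_ & _ & [] & _).
    + rewrite !ER. intros Hp Hq D.
      destruct (function_value _ _ _ (pair p q) Ff I) as (y & Hy & [-> | ->]); [|now left].
      destruct (function_value _ _ _ (pair q p) Ff I) as (y & Hy' & [-> | ->]); [|now right].
      now destruct (C p q p) as (_ & [] & _).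
    + intros Hp Hq Hr H1 H2. apply ER in H2. apply NNPP. intros N.
      now destruct (C p q r) as (_ & _ & _ & [] & _).
    + intros Hp Hq Hr H1 H2. apply ER in H1. apply NNPP. intros N.
      now destruct (C p q r) as (_ & _ & _ & _ & []).
Qed.

End Compactness.

(** * Orders on points named by block, tag and witness *)

Section Points.

Context {M : L2_structure} {HM : RCA0 M}.
Implicit Types (n w x y z : num M) (t s b : nat).

Lemma strict_order_exists (D : num M -> Prop) (before : num M -> num M -> Prop) :
  Delta1 (fun e => D (e 0%nat)) -> Delta1 (fun e => before (e 1%nat) (e 0%nat)) ->
  (forall x, D x -> ~ before x x) ->
  (forall x y z, D x -> D y -> D z -> before x y -> before y z -> before x z) ->
  exists P leP, partial_order P leP /\ (forall x, x ∈ P <-> D x) /\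
    forall x y, rel_lt leP x y <-> D x /\ D y /\ before x y.
Proof.
  intros HD Hb Hi Ht.
  destruct (comprehension D HD) as [P EP].
  destruct (rel_comprehension (fun x y => D x /\ D y /\ (x = y \/ before x y)))
    as (leP & E & S).
  { apply Delta1_and; [apply (Delta1_var D 1 HD)|]. apply Delta1_and; [exact HD|].
    apply Delta1_or; [definable | exact Hb]. }
  assert (Hlt : forall x y, rel_lt leP x y <-> D x /\ D y /\ before x y).
  { intros x y. unfold rel_lt, rel_le. rewrite E. split; [tauto|].
    intros (Dx & Dy & H). split; [auto|]. intros ->. now apply (Hi y). }
  exists P, leP. split; [|split; [exact EP | exact Hlt]].
  unfold partial_order, rel_le. split; [|split; [|split]].
  - intros z Hz. destruct (S z Hz) as (x & y & ->). apply E in Hz.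
    exists x, y. rewrite !EP. tauto.
  - intros p Hp. apply EP in Hp. apply E. auto.
  - intros p q r H1 H2. apply E in H1 as (Dp & Dq & H1), H2 as (_ & Dr & H2). apply E.
    destruct H1 as [-> | H1], H2 as [-> | H2]; eauto 6.
  - intros p q H1 H2. apply E in H1 as (Dp & Dq & H1), H2 as (_ & _ & H2).
    destruct H1 as [-> | H1], H2 as [H2 | H2]; auto.
    now destruct (Hi p Dp (Ht p q p Dp Dq Dp H1 H2)).
Qed.

Fixpoint numeral t : num M :=
  match t with O => 0 | S t => numeral t + 1 end.

Lemma numeral_inj t s : numeral t = numeral s -> t = s.
Proof.
  revert s. induction t as [|t IH]; intros [|s] H; simpl in H; auto.
  - symmetry in H. now apply (succ_neq_zero M HM) in H.
  - now apply (succ_neq_zero M HM) in H.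
  - apply (succ_inj M HM) in H. now rewrite (IH s H).
Qed.

(** The tag is a standard number, so that case distinctions on it are made in the metatheory, while
    block and witness range over the model. *)
Definition point n t w : num M := pair (pair n (numeral t)) w.

Lemma point_inj n t w n' t' w' :
  point n t w = point n' t' w' -> n = n' /\ t = t' /\ w = w'.
Proof.
  intros H. apply pair_inj in H as [H ->]. apply pair_inj in H as [-> H].
  now apply numeral_inj in H.
Qed.

Lemma term_point (a c : (nat -> num M) -> num M) t : term_def a -> term_def c ->
  term_def (fun e => point (a e) t (c e)).
Proof. intros Ha Hc. unfold point. definable. Qed.

Lemma Delta1_ex_point (R : (nat -> num M) -> num M -> num M -> Prop)
    (a : (nat -> num M) -> num M) t : term_def a ->
  Delta1 (fun e => R (fun i => e (S (S i))) (e 1%nat) (e 0%nat)) ->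
  Delta1 (fun e => exists n w, a e = point n t w /\ R e n w).
Proof.
  intros Ha HR. pose proof (term_shift _ Ha) as Ha1. pose proof (term_shift _ Ha1) as Ha2.
  apply (Delta1_ext (fun e => exists n, n < a e + 1 /\
    exists w, w < a e + 1 /\ (a e = point n t w /\ R e n w))).
  - intros e. split; [firstorder|]. intros (n & w & E & H). rewrite E.
    exists n. split; [apply lt_succ_le|].
    { unfold point. eapply le_trans; apply le_pair_l. }
    exists w. split; [apply lt_succ_le, le_pair_r | auto].
  - apply (Delta1_bex (fun e n => exists w, w < a e + 1 /\ (a e = point n t w /\ R e n w))
      (fun e => a e + 1)); [definable|].
    apply (Delta1_bex (fun e w => a (fun i => e (S i)) = point (e 0%nat) t w /\
      R (fun i => e (S i)) (e 0%nat) w) (fun e => a (fun i => e (S i)) + 1)); [definable|].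
    apply Delta1_and; [|exact HR]. apply Delta0_Delta1, Delta0_eq; [exact Ha2|].
    apply term_point; definable.
Qed.

Definition is_point b (V : nat -> num M -> num M -> Prop) z : Prop :=
  exists t, (t < b)%nat /\ exists n w, z = point n t w /\ V t n w.

Definition point_before n t w n' t' w' : Prop :=
  n < n' \/ (n = n' /\ ((t < t')%nat \/ (t = t' /\ w < w'))).

Definition points_related b (Q : nat -> num M -> num M -> nat -> num M -> num M -> Prop)
    z z' : Prop :=
  exists t, (t < b)%nat /\ exists n w, z = point n t w /\
    exists t', (t' < b)%nat /\ exists n' w', z' = point n' t' w' /\ Q t n w t' n' w'.

Lemma points_related_iff b Q t n w t' n' w' : (t < b)%nat -> (t' < b)%nat ->
  (points_related b Q (point n t w) (point n' t' w') <-> Q t n w t' n' w').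
Proof.
  intros Ht Ht'. split.
  - intros (t1 & _ & n1 & w1 & E & t2 & _ & n2 & w2 & E' & H).
    apply point_inj in E as (-> & -> & ->), E' as (-> & -> & ->). exact H.
  - intros H. exists t. split; [exact Ht|]. exists n, w. split; [reflexivity|].
    exists t'. split; [exact Ht'|]. now exists n', w'.
Qed.

Lemma point_order b V :
  (forall t, Delta1 (fun e => V t (e 1%nat) (e 0%nat))) ->
  exists L leL, linear_order L leL /\ (forall z, z ∈ L <-> is_point b V z) /\
    forall n t w n' t' w', point n t w ∈ L -> point n' t' w' ∈ L ->
      (rel_lt leL (point n t w) (point n' t' w') <-> point_before n t w n' t' w').
Proof.
  intros HV.
  pose (Q := fun t n w t' n' w' => point_before n t w n' t' w').
  destruct (strict_order_exists (is_point b V) (points_related b Q))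
    as (L & leL & HL & EL & Elt).
  - unfold is_point. apply Delta1_ex_meta. intros t.
    apply (Delta1_ex_point (fun _ => V t) (fun e => e 0%nat)); [definable | exact (HV t)].
  - unfold points_related, Q, point_before.
    apply Delta1_ex_meta. intros t. apply Delta1_ex_point; [definable|].
    apply Delta1_ex_meta. intros t'. apply Delta1_ex_point; definable.
  - intros z (t & Ht & n & w & -> & _). rewrite points_related_iff by assumption.
    intros [H | (_ & [H | (_ & H)])]; [now apply lt_irrefl in H | lia | now apply lt_irrefl in H].
  - intros x y z (t & Ht & n & w & -> & _) (t1 & Ht1 & n1 & w1 & -> & _)
      (t2 & Ht2 & n2 & w2 & -> & _).
    rewrite !points_related_iff by assumption. unfold Q, point_before.
    intros [H | (-> & H)] [H' | (-> & H')]; eauto using lt_trans.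
    right. split; [reflexivity|].
    destruct H as [H | (-> & H)], H' as [H' | (-> & H')]; eauto using lt_trans.
    left. lia.
  - assert (Hlt : forall n t w n' t' w', point n t w ∈ L -> point n' t' w' ∈ L ->
      (rel_lt leL (point n t w) (point n' t' w') <-> point_before n t w n' t' w')).
    { intros n t w n' t' w' H H'. rewrite Elt. apply EL in H, H'.
      assert (Ht : (t < b)%nat).
      { destruct H as (s & Hs & m & v & E & _). now apply point_inj in E as (_ & -> & _). }
      assert (Ht' : (t' < b)%nat).
      { destruct H' as (s & Hs & m & v & E & _). now apply point_inj in E as (_ & -> & _). }
      rewrite points_related_iff by assumption. unfold Q. tauto. }
    exists L, leL. split; [|now split]. split; [exact HL|].
    intros x y Hx Hy. pose proof Hx as Hx'. pose proof Hy as Hy'.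
    apply EL in Hx' as (t & Ht & n & w & -> & _), Hy' as (t1 & Ht1 & n1 & w1 & -> & _).
    destruct (classic (point n t w = point n1 t1 w1)) as [<- | N];
      [left; now apply (proj1 (proj2 HL))|].
    assert (K : point_before n t w n1 t1 w1 \/ point_before n1 t1 w1 n t w).
    { unfold point_before.
      destruct (trichotomy n n1) as [H | [H | H]]; [auto| |auto]. subst n1.
      destruct (lt_eq_lt_dec t t1) as [[H | H] | H]; [auto| |auto]. subst t1.
      destruct (trichotomy w w1) as [H | [H | H]]; [tauto | now subst w1 | tauto]. }
    destruct K as [K | K]; [left | right]; now apply Hlt.
Qed.

End Points.

Ltac definable_Delta1_hook ::=
  first [ apply Delta1_divides; definable_term
        | apply Delta1_fin_mem; definable_term
        | apply Delta1_fin_seq; definable_term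
        | apply Delta1_binary_seq; definable_term
        | apply Delta1_seq_length; definable_term
        | apply Delta1_initial_segment; definable_term
        | apply Delta1_ex_point; definable
        | progress unfold frame, seq_entry, maps_to, fiber, rel_lt, rel_le; definable ].

(** * Separation from compatible orders *)

(** Tags 0 to 3 get the closed intervals [1,1], [2,3], [0,5] and [4,4]. Tags 1 and 2 are a_n and
    b_n; the gaps on both sides of [2,3] inside [0,5] hold the witness elements, comparable to a_n
    but not to b_n. *)
Definition left_tag (t : nat) : nat :=
  match t with 0 => 1 | 1 => 2 | 2 => 0 | _ => 4 end.

Definition right_tag (t : nat) : nat :=
  match t with 0 => 1 | 1 => 3 | 2 => 5 | _ => 4 end.

Section Block.

Context {M : L2_structure} {HM : RCA0 M} (A B : num M -> Prop).
Implicit Types (w : num M) (t s : nat).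

(** Elements of one block of the partial order: [1] and [2] are always present, an
    element with tag [3] lies above [1] only, and one with tag [0] lies below [1] only. *)
Definition element t w : Prop :=
  match t with 0 => B w | 1 => w = 0 | 2 => w = 0 | 3 => A w | _ => False end.

(** The points available for intervals. Since [A] and [B] are not both inhabited,
    one of [1] and [2] can be enlarged to the left and the other one to the right
    as soon as a witness appears; without witnesses both are the single point [3]. *)
Definition spot s w : Prop :=
  match s with
  | 1 => B w | 2 => A w \/ B w | 3 => w = 0 | 4 => A w \/ B w | 5 => A w | _ => False
  end.

(** With witnesses in [A], elements 1, 2, 3 occupy spots 2-3, 3-4, 4-5; with witnesses in [B],
    elements 0, 2, 1 occupy spots 1-2, 2-3, 3-4. Either way the intervals form a staircase without
    proper inclusions. All witness elements of one kind share an interval. *)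
Definition interval t s w : Prop :=
  match t, s with
  | 0, 1 | 0, 2 => B w
  | 1, 2 => A w | 1, 3 => w = 0 | 1, 4 => B w
  | 2, 2 => B w | 2, 3 => w = 0 | 2, 4 => A w
  | 3, 4 | 3, 5 => A w
  | _, _ => False
  end.

Context (AB : forall v w, A v -> B w -> False).

Ltac tags t := destruct t as [|[|[|[|[|[|t]]]]]]; simpl in *; try contradiction.

Lemma interval_spot t s w : interval t s w -> spot s w.
Proof. intros H. tags t; tags s; auto. Qed.

Lemma interval_tag t s w : interval t s w -> (t < 4)%nat /\ (s < 6)%nat.
Proof. intros H. tags t; tags s; lia. Qed.

Lemma interval_inhabited t w : element t w -> exists s v, interval t s v.
Proof.
  intros H. tags t.
  - now exists 1%nat, w.
  - now exists 3%nat, 0.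
  - now exists 3%nat, 0.
  - now exists 4%nat, w.
Qed.

Lemma interval_convex t s w s' w' s1 w1 :
  interval t s w -> interval t s' w' -> spot s1 w1 -> (s <= s1 <= s')%nat ->
  interval t s1 w1.
Proof.
  intros H H' H1 L.
  tags t; tags s; tags s'; tags s1; try lia; try tauto;
    try (destruct H1); try assumption; exfalso; eauto.
Qed.

Lemma interval_before t t' s w s' w' : (right_tag t < left_tag t')%nat ->
  interval t s w -> interval t' s' w' -> (s < s')%nat.
Proof.
  intros L H H'. tags t; tags t'; try lia; tags s; tags s'; try lia; exfalso; eauto.
Qed.

Lemma interval_meet t t' v v' : element t v -> element t' v' ->
  ~ (right_tag t < left_tag t')%nat ->
  exists s w s' w', interval t s w /\ interval t' s' w' /\
    ((s' < s)%nat \/ (s = s' /\ w = w')).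
Proof.
  intros H H' L. tags t; tags t'; try lia; try (exfalso; eauto; fail).
  - exists 1%nat, v, 1%nat, v. auto.
  - exists 2%nat, v, 2%nat, v. auto.
  - exists 4%nat, v', 2%nat, v'. auto with arith.
  - exists 3%nat, 0, 3%nat, 0. auto.
  - exists 3%nat, 0, 3%nat, 0. auto.
  - exists 2%nat, v', 2%nat, v'. auto.
  - exists 3%nat, 0, 3%nat, 0. auto.
  - exists 3%nat, 0, 3%nat, 0. auto.
  - exists 4%nat, v', 4%nat, v'. auto.
  - exists 4%nat, v, 3%nat, 0. auto with arith.
  - exists 4%nat, v, 4%nat, v. auto.
  - exists 4%nat, v, 4%nat, v. auto.
Qed.

Lemma interval_incl t t' v v' : element t v -> element t' v' ->
  (forall s w, interval t s w -> interval t' s w) ->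
  forall s w, interval t' s w -> interval t s w.
Proof.
  (* These instances settle all cases: the outer spots 1 and 5 at the witness of [t], the common
     spot 3, and the spots 2 and 4 both at the point in question and at the witness of [t']. *)
  intros H H' I s w Hs. pose proof (I 1%nat v) as I1. pose proof (I 5%nat v) as I5.
  pose proof (I 3%nat 0) as I3. pose proof (I 2%nat w) as I2. pose proof (I 4%nat w) as I4.
  pose proof (I 2%nat v') as I2'. pose proof (I 4%nat v') as I4'.
  tags t; tags t'; tags s; auto; exfalso; eauto.
Qed.

End Block.

(** * The order coding two disjoint classes and its two representations *)

Section Gadget.

Context {M : L2_structure} {HM : RCA0 M} (A B : set M).
Context (AB : forall n v w, pair n v ∈ A -> pair n w ∈ B -> False).
Implicit Types (n w x y z : num M) (t s : nat).

Definition block_element n t w : Prop :=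
  element (fun v => pair n v ∈ A) (fun v => pair n v ∈ B) t w.

Definition block_spot n s w : Prop :=
  spot (fun v => pair n v ∈ A) (fun v => pair n v ∈ B) s w.

Definition block_interval n t s w : Prop :=
  interval (fun v => pair n v ∈ A) (fun v => pair n v ∈ B) t s w.

Lemma Delta1_block_element (a c : (nat -> num M) -> num M) t :
  term_def a -> term_def c -> Delta1 (fun e => block_element (a e) t (c e)).
Proof.
  intros Ha Hc. destruct t as [|[|[|[|t]]]]; unfold block_element; simpl; definable.
Qed.

Lemma Delta1_block_spot (a c : (nat -> num M) -> num M) s :
  term_def a -> term_def c -> Delta1 (fun e => block_spot (a e) s (c e)).
Proof.
  intros Ha Hc. destruct s as [|[|[|[|[|[|s]]]]]]; unfold block_spot; simpl; definable.
Qed.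

Lemma Delta1_block_interval (a c : (nat -> num M) -> num M) t s :
  term_def a -> term_def c -> Delta1 (fun e => block_interval (a e) t s (c e)).
Proof.
  intros Ha Hc. destruct t as [|[|[|[|t]]]], s as [|[|[|[|[|[|s]]]]]];
    unfold block_interval; simpl; definable.
Qed.

Definition gadget_before t n (w : num M) t' n' (w' : num M) : Prop :=
  n < n' \/ (n = n' /\ (right_tag t < left_tag t')%nat).

Definition is_gadget P leP : Prop :=
  partial_order P leP /\
  (forall z, z ∈ P <-> is_point 4 (fun t n w => block_element n t w) z) /\
  forall t n w t' n' w', point n t w ∈ P -> point n' t' w' ∈ P ->
    (rel_lt leP (point n t w) (point n' t' w') <-> gadget_before t n w t' n' w').

Lemma is_gadget_exists : exists P leP, is_gadget P leP.
Proof.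
  assert (LR : forall t, (t < 4)%nat -> (left_tag t <= right_tag t)%nat).
  { intros [|[|[|[|t]]]] Ht; simpl; lia. }
  destruct (strict_order_exists (is_point 4 (fun t n w => block_element n t w))
    (points_related 4 gadget_before)) as (P & leP & HP & EP & Elt).
  - unfold is_point. apply Delta1_ex_meta. intros t. apply Delta1_ex_point; [definable|].
    apply Delta1_block_element; definable.
  - unfold points_related, gadget_before. definable.
  - intros z (t & Ht & n & w & -> & _). rewrite points_related_iff by assumption.
    intros [H | (_ & H)]; [now apply lt_irrefl in H | specialize (LR t Ht); lia].
  - intros x y z (t & Ht & n & w & -> & _) (t1 & Ht1 & n1 & w1 & -> & _)
      (t2 & Ht2 & n2 & w2 & -> & _).
    rewrite !points_related_iff by assumption. unfold gadget_before.
    intros [H | (-> & H)] [H' | (-> & H')]; eauto using lt_trans.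
    right. split; [reflexivity|]. specialize (LR t1 Ht1). lia.
  - exists P, leP. split; [exact HP|]. split; [exact EP|].
    intros t n w t' n' w' H H'. rewrite Elt. apply EP in H, H'.
    assert (Ht : (t < 4)%nat).
    { destruct H as (s & Hs & m & v & E & _). now apply point_inj in E as (_ & -> & _). }
    assert (Ht' : (t' < 4)%nat).
    { destruct H' as (s & Hs & m & v & E & _). now apply point_inj in E as (_ & -> & _). }
    rewrite points_related_iff by assumption. tauto.
Qed.

Section Representations.

Context {P leP : set M} (HG : is_gadget P leP).

Lemma gadget_point n t w : point n t w ∈ P <-> (t < 4)%nat /\ block_element n t w.
Proof.
  destruct HG as (_ & EP & _). rewrite EP. split.
  - intros (t' & Ht & n' & w' & E & H). now apply point_inj in E as (-> & -> & ->).
  - intros [Ht H]. exists t. split; [exact Ht|]. now exists n, w.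
Qed.

Lemma gadget_case z : z ∈ P -> exists n t w, z = point n t w.
Proof.
  destruct HG as (_ & EP & _). rewrite EP. intros (t & _ & n & w & E & _).
  now exists n, t, w.
Qed.

Lemma gadget_endpoint L g : (forall t, (t < 4)%nat -> (g t < 6)%nat) ->
  (forall z, z ∈ L <-> is_point 6 (fun _ _ w => w = 0) z) ->
  exists f, is_function (mem P) (mem L) f /\
    forall n t w, point n t w ∈ P ->
      forall y, maps_to f (point n t w) y <-> y = point n (g t) 0.
Proof.
  intros Hg EL.
  destruct (function_exists P L (fun x y => exists t, (t < 4)%nat /\
    exists n w, x = point n t w /\ y = point n (g t) 0)) as (f & Ff & Ef).
  - apply Delta1_ex_meta. intros t. apply Delta1_ex_point; [definable|].
    apply Delta0_Delta1, Delta0_eq; [definable | apply term_point; definable].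
  - intros x Hx. destruct (gadget_case x Hx) as (n & t & w & ->).
    apply gadget_point in Hx as [Ht _]. exists (point n (g t) 0). split.
    + exists t. split; [exact Ht|]. now exists n, w.
    + intros y (t' & _ & n' & w' & E & ->). now apply point_inj in E as (-> & -> & ->).
  - intros x y _ (t & Ht & n & w & _ & ->). apply EL. exists (g t).
    split; [now apply Hg|]. now exists n, 0.
  - exists f. split; [exact Ff|]. intros n t w H y. rewrite Ef. split.
    + intros (_ & t' & _ & n' & w' & E & ->). now apply point_inj in E as (-> & -> & ->).
    + intros ->. split; [exact H|]. apply gadget_point in H as [Ht _].
      exists t. split; [exact Ht|]. now exists n, w.
Qed.

(** Witnesses affect only which elements are present; endpoints are read off from block and tag. *)
Lemma gadget_closed : closed_interval_order P leP.
Proof.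
  destruct (point_order 6 (fun _ _ w => w = 0)) as (L & leL & HL & EL & Elt);
    [intros; definable|].
  destruct (gadget_endpoint L left_tag) as (f0 & F0 & E0); auto.
  { intros [|[|[|[|t]]]] Ht; simpl; lia. }
  destruct (gadget_endpoint L right_tag) as (f1 & F1 & E1); auto.
  { intros [|[|[|[|t]]]] Ht; simpl; lia. }
  assert (Hin : forall n t, (t < 6)%nat -> point n t 0 ∈ L).
  { intros n t Ht. apply EL. exists t. split; [exact Ht|]. now exists n, 0. }
  exists L, leL, f0, f1. split; [exact HL|]. split; [exact F0|]. split; [exact F1|].
  split.
  - intros p x y Hp Hx Hy. destruct (gadget_case p Hp) as (n & t & w & ->).
    apply E0 in Hx; auto. apply E1 in Hy; auto. subst x y.
    apply gadget_point in Hp as [Ht _].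
    apply NNPP. intros N.
    apply (linear_not_le L) in N; auto; try (apply Hin);
      try (destruct t as [|[|[|[|t]]]]; simpl; lia).
    apply Elt in N; try (apply Hin); try (destruct t as [|[|[|[|t]]]]; simpl; lia).
    destruct N as [N | (_ & [N | (_ & N)])]; try now apply lt_irrefl in N.
    destruct t as [|[|[|[|t]]]]; simpl in N; lia.
  - intros p q x y Hp Hq Hx Hy.
    destruct (gadget_case p Hp) as (n & t & w & ->), (gadget_case q Hq) as (n' & t' & w' & ->).
    apply E1 in Hx; auto. apply E0 in Hy; auto. subst x y.
    rewrite (proj2 (proj2 HG)) by assumption.
    apply gadget_point in Hp as [Ht _], Hq as [Ht' _].
    rewrite Elt; try (apply Hin; destruct t as [|[|[|[|t]]]], t' as [|[|[|[|t']]]];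
      simpl; lia).
    unfold gadget_before, point_before. pose proof (lt_irrefl (0 : num M)). tauto.
Qed.

(** The line consists of the spots of all blocks in lexicographic order. A spot carries its witness
    in its name, so whether it belongs to an interval is decidable. Intervals never leave their
    block, which reduces each condition to one block. *)
Lemma gadget_proper : proper_interval_order P leP.
Proof.
  destruct (point_order 6 (fun s n w => block_spot n s w)) as (L & leL & HL & EL & Elt).
  { intros s. apply Delta1_block_spot; definable. }
  destruct (rel_comprehension (fun z x => z ∈ P /\ exists t, (t < 4)%nat /\
    exists n w, z = point n t w /\ exists s, (s < 6)%nat /\
    exists n' v, x = point n' s v /\ (n = n' /\ block_interval n t s v)))
    as (F & EF & SF).
  { apply Delta1_and; [definable|].
    apply Delta1_ex_meta. intros t. apply Delta1_ex_point; [definable|].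
    apply Delta1_ex_meta. intros s. apply Delta1_ex_point; [definable|].
    apply Delta1_and; [definable|]. apply Delta1_block_interval; definable. }
  assert (Hin : forall n t w x, point n t w ∈ P ->
      (fiber F (point n t w) x <->
       exists s v, x = point n s v /\ block_interval n t s v)).
  { intros n t w x Hp. unfold fiber. rewrite EF. split.
    - intros (_ & t' & _ & n' & w' & E & s & _ & n2 & v & -> & <- & H).
      apply point_inj in E as (-> & -> & ->). now exists s, v.
    - intros (s & v & -> & H). destruct (interval_tag _ _ _ _ _ H) as [Ht Hs].
      split; [exact Hp|]. exists t. split; [exact Ht|]. exists n, w.
      split; [reflexivity|]. exists s. split; [exact Hs|]. now exists n, v. }
  assert (HinL : forall n t s v, block_interval n t s v -> point n s v ∈ L).
  { intros n t s v H. apply EL. exists s. split; [eapply interval_tag, H|].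
    exists n, v. split; [reflexivity | eapply interval_spot, H]. }
  assert (AB' : forall n v w, (fun x => pair n x ∈ A) v -> (fun x => pair n x ∈ B) w -> False)
    by (simpl; eauto).
  exists L, leL, F. split; [exact HL|]. split; [|split; [|split]].
  - intros z Hz. destruct (SF z Hz) as (p & x & ->). exists p, x.
    pose proof Hz as Hp. apply EF in Hp as [Hp _].
    destruct (gadget_case p Hp) as (n & t & w & ->). apply Hin in Hz; auto.
    destruct Hz as (s & v & -> & H). eauto.
  - intros p Hp. destruct (gadget_case p Hp) as (n & t & w & ->). split.
    + pose proof Hp as Hp'. apply gadget_point in Hp' as [_ H].
      destruct (interval_inhabited _ _ _ _ H) as (s & v & Hs).
      exists (point n s v). apply Hin; [exact Hp|]. now exists s, v.
    + intros x y z Hx Hz Hy Hxy Hyz. rewrite Hin in * by exact Hp.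
      destruct Hx as (s & v & -> & Hx), Hz as (s' & v' & -> & Hz).
      assert (Ey : exists n1 s1 v1, y = point n1 s1 v1 /\ block_spot n1 s1 v1).
      { apply EL in Hy as (s1 & _ & n1 & v1 & E & H). now exists n1, s1, v1. }
      destruct Ey as (n1 & s1 & v1 & -> & H1).
      assert (K : forall n s v n' s' v', point n s v ∈ L -> point n' s' v' ∈ L ->
          rel_le leL (point n s v) (point n' s' v') ->
          n < n' \/ (n = n' /\ (s <= s')%nat)).
      { intros m a b m' a' b' Ha Ha' H.
        destruct (classic (point m a b = point m' a' b')) as [E | N].
        - apply point_inj in E as (-> & -> & _). auto.
        - assert (H' : rel_lt leL (point m a b) (point m' a' b')) by now split.
          apply Elt in H'; auto. destruct H' as [H' | (-> & [H' | (-> & _)])]; auto with arith. }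
      apply K in Hxy; eauto. apply K in Hyz; eauto.
      assert (E : n = n1).
      { destruct Hxy as [Hxy | [E _]]; [|exact E].
        destruct Hyz as [Hyz | [E _]]; [|now symmetry].
        now destruct (lt_irrefl n (lt_trans _ _ _ Hxy Hyz)). }
      subst n1. exists s1, v1. split; [reflexivity|].
      apply (interval_convex _ _ (AB' n) t s v s' v' s1 v1 Hx Hz H1).
      pose proof (lt_irrefl n). tauto.
  - intros p q Hp Hq.
    destruct (gadget_case p Hp) as (n & t & w & ->), (gadget_case q Hq) as (n' & t' & w' & ->).
    rewrite (proj2 (proj2 HG)) by assumption. split.
    + intros H x y Hx Hy. rewrite Hin in * by assumption.
      destruct Hx as (s & v & -> & Hx), Hy as (s' & v' & -> & Hy).
      apply Elt; eauto. destruct H as [H | (<- & H)]; [now left | right].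
      split; [reflexivity|]. left. exact (interval_before _ _ (AB' n) _ _ _ _ _ _ H Hx Hy).
    + intros H. pose proof Hp as Hp'. pose proof Hq as Hq'.
      apply gadget_point in Hp' as [_ Hp'], Hq' as [_ Hq'].
      destruct (trichotomy n n') as [L1 | [L1 | L1]]; [now left| |].
      * subst n'. right. split; [reflexivity|]. apply NNPP. intros N.
        destruct (interval_meet _ _ (AB' n) _ _ _ _ Hp' Hq' N)
          as (s & v & s' & v' & Hs & Hs' & D).
        assert (C : rel_lt leL (point n s v) (point n s' v')).
        { apply H; apply Hin; eauto. }
        apply Elt in C; eauto.
        destruct C as [C | (_ & C)]; [now apply lt_irrefl in C|].
        destruct D as [D | (-> & ->)]; [lia|].
        destruct C as [C | (_ & C)]; [lia | now apply lt_irrefl in C].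
      * exfalso. destruct (interval_inhabited _ _ _ _ Hp') as (s & v & Hs).
        destruct (interval_inhabited _ _ _ _ Hq') as (s' & v' & Hs').
        assert (C : rel_lt leL (point n s v) (point n' s' v')).
        { apply H; apply Hin; eauto. }
        apply Elt in C; eauto. destruct C as [C | (-> & _)].
        -- exact (lt_irrefl n (lt_trans _ _ _ C L1)).
        -- exact (lt_irrefl _ L1).
  - intros p q Hp Hq H.
    destruct (gadget_case p Hp) as (n & t & w & ->), (gadget_case q Hq) as (n' & t' & w' & ->).
    pose proof Hp as Hp'. pose proof Hq as Hq'.
    apply gadget_point in Hp' as [_ Hp'], Hq' as [_ Hq'].
    assert (E : n = n').
    { destruct (interval_inhabited _ _ _ _ Hp') as (s & v & Hs).
      assert (C : fiber F (point n' t' w') (point n s v)) by (apply H, Hin; eauto).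
      apply Hin in C as (s' & v' & C & _); [|exact Hq]. now apply point_inj in C as (-> & _). }
    subst n'. intros x. split; [apply H|]. intros Hx. apply Hin in Hx; [|exact Hq].
    destruct Hx as (s & v & -> & Hx). apply Hin; [exact Hp|]. exists s, v.
    split; [reflexivity|]. revert s v Hx.
    apply (interval_incl _ _ t t' w w' Hp' Hq'). intros s v Hs.
    assert (C : fiber F (point n t' w') (point n s v)) by (apply H, Hin; eauto).
    apply Hin in C as (s' & v' & C & C'); [|exact Hq].
    now apply point_inj in C as (_ & -> & ->).
Qed.

Lemma gadget_separation R : compatible_order P leP R ->
  exists S : set M, forall n w, (pair n w ∈ A -> n ∈ S) /\ (pair n w ∈ B -> ~ n ∈ S).
Proof.
  intros C. destruct (comprehension (fun n => pair (point n 1 0) (point n 2 0) ∈ R))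
    as [S HS].
  { apply Delta0_Delta1, Delta0_mem. apply term_pair; apply term_point; definable. }
  destruct HG as (_ & _ & Elt).
  assert (H1 : forall n, point n 1 0 ∈ P) by (intros; apply gadget_point; split; [lia|easy]).
  assert (H2 : forall n, point n 2 0 ∈ P) by (intros; apply gadget_point; split; [lia|easy]).
  exists S. intros n w. rewrite HS. split.
  - intros Hw.
    assert (H3 : point n 3 w ∈ P) by (apply gadget_point; split; [lia|exact Hw]).
    apply NNPP. intros N.
    destruct (compat_total _ _ _ C _ _ (H1 n) (H2 n)) as [K | K]; [|contradiction|].
    { intros E. now apply point_inj in E as (_ & E & _). }
    assert (K' : rel_lt leP (point n 2 0) (point n 3 w)).
    { apply (compat_r _ _ _ C _ (point n 1 0)); auto. apply Elt; auto. right.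
      split; [reflexivity | simpl; lia]. }
    apply Elt in K'; auto. destruct K' as [K' | (_ & K')]; [now apply lt_irrefl in K'|].
    simpl in K'. lia.
  - intros Hw K.
    assert (H0 : point n 0 w ∈ P) by (apply gadget_point; split; [lia|exact Hw]).
    assert (K' : rel_lt leP (point n 0 w) (point n 2 0)).
    { apply (compat_l _ _ _ C _ (point n 1 0)); auto. apply Elt; auto. right.
      split; [reflexivity | simpl; lia]. }
    apply Elt in K'; auto. destruct K' as [K' | (_ & K')]; [now apply lt_irrefl in K'|].
    simpl in K'. lia.
Qed.

End Representations.

End Gadget.

(** * Weak König's Lemma from separation *)

Section Separation.

Context {M : L2_structure} {HM : RCA0 M}.
Implicit Types (A B S T : set M) (i j k l n b r s t : num M).

(** The Sigma^0_1 classes are the projections of [A] and [B]; second components are the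
    witnesses. *)
Definition separation_principle : Prop :=
  forall A B, (forall n v w, pair n v ∈ A -> pair n w ∈ B -> False) ->
    exists S, forall n w, (pair n w ∈ A -> n ∈ S) /\ (pair n w ∈ B -> ~ n ∈ S).

Lemma Sigma1_matrix_set (R : num M -> Prop) : Sigma1 (fun e => R (e 0%nat)) ->
  exists A, forall n, R n <-> exists w, pair n w ∈ A.
Proof.
  intros (Q & HQ & HR).
  (* Filling all variables other than the witness with [n] is harmless, since the predicate depends
     on variable 0 only. *)
  destruct (rel_comprehension (fun n w => Q (env_cons w (fun _ => n)))) as (A & EA & _).
  - apply Delta0_Delta1, (Delta0_subst Q
      (fun i : nat => inl match i with O => 0%nat | _ => 1%nat end)
      (fun e => env_cons (e 0%nat) (fun _ => e 1%nat))); [|exact HQ].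
    now intros e [|i].
  - exists A. intros n. setoid_rewrite EA. apply (HR (fun _ => n)).
Qed.

Lemma Sigma1_separation (R Q : num M -> Prop) : separation_principle ->
  Sigma1 (fun e => R (e 0%nat)) -> Sigma1 (fun e => Q (e 0%nat)) ->
  (forall n, R n -> Q n -> False) ->
  exists S, forall n, (R n -> n ∈ S) /\ (Q n -> ~ n ∈ S).
Proof.
  intros Sep HR HQ D.
  destruct (Sigma1_matrix_set R HR) as [A EA], (Sigma1_matrix_set Q HQ) as [B EB].
  destruct (Sep A B) as [S HS].
  - intros n v w Hv Hw. apply (D n); [apply EA; now exists v | apply EB; now exists w].
  - exists S. intros n. split.
    + intros H. apply EA in H as [w Hw]. now apply (HS n w).
    + intros H. apply EB in H as [w Hw]. now apply (HS n w).
Qed.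

Section Path.

Context {T : set M} (HT : binary_tree T) (IT : infinite T).

Lemma tree_restrict t n k : t ∈ T -> seq_length t n -> le k n ->
  exists r, r ∈ T /\ binary_seq r /\ seq_length r k /\ initial_segment r t.
Proof.
  intros Ht Lt Hk.
  destruct (binary_seq_restrict t n k) as (r & Br & Lr & Hr); auto; [now apply HT|].
  exists r. split; [|auto]. apply (proj2 HT r t Ht); [apply Br | exact Hr].
Qed.

(** A tree without nodes of length [n] has only shorter ones, since longer nodes restrict to length
    [n], and the frame bounds the codes of all of these. *)
Lemma tree_level n : exists t, t ∈ T /\ seq_length t n.
Proof.
  apply NNPP. intros N. destruct (frame_exists (pair n 1)) as [b Hb].
  apply IT. exists (b + 1). intros x Hx.
  pose proof (proj1 HT x Hx) as Bx. pose proof Bx as [(_ & _ & _ & m & Lx) _].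
  destruct (lt_or_le m n) as [L | L].
  - exact (binary_seq_bound x m n b Bx Lx (lt_le _ _ L) Hb).
  - exfalso. destruct (tree_restrict x m n Hx Lx L) as (r & Hr & _ & Lr & _).
    apply N. now exists r.
Qed.

(** Here [l] is meant to be the length of [r]. *)
Definition extends r l j n : Prop :=
  exists t, t ∈ T /\ seq_length t n /\ initial_segment r t /\ seq_entry t l j.

Lemma extends_lt r l j n : extends r l j n -> l < n.
Proof. intros (t & _ & Lt & _ & H). apply Lt. now exists j. Qed.

Lemma extends_mono r l j n k : seq_length r l -> extends r l j n -> le k n -> l < k ->
  extends r l j k.
Proof.
  intros Lr (t & Ht & Lt & Hrt & Hj) Hk Hl.
  destruct (tree_restrict t n k Ht Lt Hk) as (u & Hu & Bu & Lu & Hut).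
  pose proof (proj1 HT t Ht) as [Ft _].
  exists u. split; [exact Hu|]. split; [exact Lu|]. split.
  - intros i j' H. apply (initial_segment_entry u t k); auto.
    apply (lt_trans _ l); [|exact Hl]. apply Lr. now exists j'.
  - now apply (initial_segment_entry u t k).
Qed.

(** [forces] also uses this negated, where an unbounded search for [t] would not be Sigma^0_1. A
    frame supplies a large enough [b]. *)
Definition extends_below r l j n b : Prop :=
  exists t, t < b + 1 /\ (t ∈ T /\ seq_length t n /\ initial_segment r t /\ seq_entry t l j).

Lemma extends_below_iff r l j n b : frame (pair n 1) b ->
  (extends_below r l j n b <-> extends r l j n).
Proof.
  intros Hb. split.
  - intros (t & _ & H). now exists t.
  - intros (t & Ht & Lt & H). exists t. split; [|auto].
    apply (binary_seq_bound t n n); auto using le_refl. now apply HT.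
Qed.

(** Level [n] is reached through [j] but not through [j'], which thus dies first. Length and frame
    are decidable conditions, so quantifying over [l] and [b] keeps the predicate Sigma^0_1. *)
Definition forces j j' r : Prop := exists l n b, seq_length r l /\ frame (pair n 1) b /\
  extends_below r l j n b /\ ~ extends_below r l j' n b.

Lemma forces_iff j j' r l : seq_length r l ->
  (forces j j' r <-> exists n, extends r l j n /\ ~ extends r l j' n).
Proof.
  intros Lr. split.
  - intros (l' & n & b & Lr' & Hb & H & H').
    rewrite (seq_length_unique _ _ _ Lr' Lr) in H, H'.
    rewrite extends_below_iff in H, H' by exact Hb. now exists n.
  - intros (n & H & H'). destruct (frame_exists (pair n 1)) as [b Hb].
    exists l, n, b. split; [exact Lr|]. split; [exact Hb|].
    now rewrite !extends_below_iff by exact Hb.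
Qed.

Lemma forces_disjoint j j' r : forces j j' r -> forces j' j r -> False.
Proof.
  intros H H'. pose proof H as (l & _ & _ & Lr & _).
  apply (forces_iff _ _ _ l Lr) in H as (n & H & N), H' as (k & H' & N').
  pose proof (extends_lt _ _ _ _ H) as Ln. pose proof (extends_lt _ _ _ _ H') as Lk.
  destruct (lt_or_le n k) as [L | L].
  - apply N. apply (extends_mono r l j' k n); auto using lt_le.
  - apply N'. now apply (extends_mono r l j n k).
Qed.

Context {S : set M} (HS : forall r, (forces 1 0 r -> r ∈ S) /\ (forces 0 1 r -> ~ r ∈ S)).

(** [S] is consulted at every initial segment about the next entry. Quantifying the segments
    existentially makes this Sigma^0_1, as needed for the induction in [guided_exists]. *)
Definition guided s n : Prop := binary_seq s /\ seq_length s n /\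
  forall i, i < n -> exists r, binary_seq r /\ seq_length r i /\ initial_segment r s /\
    (seq_entry s i 1 <-> r ∈ S).

Lemma guided_exists n : exists s, guided s n.
Proof.
  pattern n. revert n. apply Sigma1_induct.
  - unfold guided. definable.
  - destruct (binary_seq_exists 0 (fun _ => False)) as (s & Bs & Ls & _); [definable|].
    exists s. split; [exact Bs|]. split; [exact Ls|].
    intros i Hi. now destruct (not_lt_zero M HM i).
  - intros n (s & Bs & Ls & Hs).
    destruct (binary_seq_exists (n + 1) (fun i => seq_entry s i 1 \/ (i = n /\ s ∈ S)))
      as (t & Bt & Lt & Ht); [definable|].
    assert (E : forall i, i < n -> (seq_entry s i 1 <-> seq_entry t i 1)).
    { intros i Hi. rewrite Ht by (apply lt_succ_le; now apply lt_le).
      split; [auto|]. intros [H | [-> _]]; [exact H | now apply lt_irrefl in Hi]. }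
    assert (Hst : initial_segment s t).
    { intros i j Hj. assert (Hi : i < n) by (apply Ls; now exists j).
      apply (binary_entry_agree s t n (n + 1)); auto.
      apply lt_succ_le. now apply lt_le. }
    exists t. split; [exact Bt|]. split; [exact Lt|].
    intros i Hi. apply (lt_succ M HM) in Hi as [Hi | ->].
    + destruct (Hs i Hi) as (r & Br & Lr & Hr & H). exists r.
      split; [exact Br|]. split; [exact Lr|]. rewrite <- (E i Hi). split; [|exact H].
      intros k j Hk. apply Hst, Hr, Hk.
    + exists s. split; [exact Bs|]. split; [exact Ls|]. split; [exact Hst|].
      rewrite Ht by apply lt_one_succ. split; [|auto]. intros [H | [_ H]]; [|exact H].
      exfalso. apply (lt_irrefl n), Ls. now exists 1.
Qed.

Lemma guided_coherent s t n k i : guided s n -> guided t k -> i < n -> i < k ->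
  forall j, seq_entry s i j <-> seq_entry t i j.
Proof.
  intros (Bs & Ls & Hs) (Bt & Lt & Ht).
  assert (H : forall i, i < n + 1 -> i < k + 1 -> forall i', i' < i ->
      (seq_entry s i' 1 <-> seq_entry t i' 1)).
  { clear i. apply (Sigma1_induct (fun i => i < n + 1 -> i < k + 1 -> forall i', i' < i ->
      (seq_entry s i' 1 <-> seq_entry t i' 1))); [definable| |].
    - intros _ _ i Hi. now destruct (not_lt_zero M HM i).
    - intros i IH Hn Hk i' Hi'.
      assert (Hn' : i < n) by now apply succ_lt_succ.
      assert (Hk' : i < k) by now apply succ_lt_succ.
      specialize (IH (lt_trans _ _ _ (lt_one_succ _) Hn) (lt_trans _ _ _ (lt_one_succ _) Hk)).
      apply (lt_succ M HM) in Hi' as [Hi' | ->]; [now apply IH|].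
      destruct (Hs i Hn') as (r & Br & Lr & Hr & Er),
        (Ht i Hk') as (r' & Br' & Lr' & Hr' & Er').
      replace r' with r in Er'; [tauto|]. apply (binary_seq_ext r r' i); auto.
      intros m Hm. rewrite (initial_segment_entry r s i m 1 Lr (proj1 Bs) Hr Hm).
      rewrite (initial_segment_entry r' t i m 1 Lr' (proj1 Bt) Hr' Hm). now apply IH. }
  intros Hn Hk j. apply (binary_entry_agree s t n k); auto.
  apply (H (i + 1)); [| |apply lt_one_succ]; now apply succ_lt_succ.
Qed.

(** Induction on [i] for the fixed level [n]: some node of length [n] agrees with [s] below [i].
    Only survival up to level [n] is maintained, since having infinitely many extensions would be
    too complex for the induction. *)
Lemma guided_in_tree s n : guided s n -> s ∈ T.
Proof.
  intros (Bs & Ls & Hs).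
  assert (H : forall i, i < n + 1 -> exists t, t ∈ T /\ seq_length t n /\
      forall k, k < i -> (seq_entry s k 1 <-> seq_entry t k 1)).
  { apply (Sigma1_induct (fun i => i < n + 1 -> exists t, t ∈ T /\ seq_length t n /\
      forall k, k < i -> (seq_entry s k 1 <-> seq_entry t k 1))); [definable| |].
    - intros _. destruct (tree_level n) as (t & Ht & Lt). exists t.
      split; [exact Ht|]. split; [exact Lt|].
      intros k Hk. now destruct (not_lt_zero M HM k).
    - intros i IH Hi.
      destruct IH as (t & Ht & Lt & Et); [exact (lt_trans _ _ _ (lt_one_succ _) Hi)|].
      assert (Hin : i < n) by now apply succ_lt_succ.
      pose proof (proj1 HT t Ht) as Bt.
      destruct (Hs i Hin) as (r & Br & Lr & Hr & Er).
      assert (Hrt : initial_segment r t).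
      { intros k j Hj. assert (Hk : k < i) by (apply Lr; now exists j).
        pose proof (lt_trans _ _ _ Hk Hin) as Hkn.
        apply (binary_entry_agree s t n n); auto. }
      (* If the entry chosen by [S] did not reach level [n], then [t] would pass through the other
         value, so that value would be forced and [S] would have chosen it. *)
      assert (K : forall j, seq_entry s i j -> extends r i j n).
      { intros j Hj. apply NNPP. intros N.
        assert (Hf : forall j', seq_entry t i j' -> forces j' j r).
        { intros j' Hj'. apply (forces_iff _ _ _ i Lr). exists n. split; [|exact N].
          now exists t. }
        assert (N' : ~ seq_entry t i j) by (intros Hj'; apply N; now exists t).
        destruct (proj2 Bs _ _ Hj) as [-> | ->].
        - destruct (binary_entry_cases t n i Bt Lt Hin) as [C | C]; [contradiction|].
          apply Hf, HS, Er in C. now apply (binary_entry_unique s i).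
        - destruct (binary_entry_cases t n i Bt Lt Hin) as [C | C]; [|contradiction].
          apply Hf, HS in C. now apply C, Er. }
      assert (Hj : exists j, seq_entry s i j) by now apply Ls.
      destruct Hj as [j Hj]. destruct (K j Hj) as (u & Hu & Lu & Hru & Hju).
      pose proof (proj1 HT u Hu) as Bu.
      exists u. split; [exact Hu|]. split; [exact Lu|].
      intros k Hk. apply (lt_succ M HM) in Hk as [Hk | ->].
      + rewrite <- (initial_segment_entry r s i k 1 Lr (proj1 Bs) Hr Hk).
        apply (initial_segment_entry r u i k 1 Lr (proj1 Bu) Hru Hk).
      + pose proof (proj1 Bs) as (_ & _ & Us & _). pose proof (proj1 Bu) as (_ & _ & Uu & _).
        split; intros H1.
        * now rewrite <- (Us i j 1 Hj H1).
        * now rewrite <- (Uu i j 1 Hju H1). }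
  destruct (H n (lt_one_succ n)) as (t & Ht & Lt & E).
  rewrite (binary_seq_ext s t n); auto. now apply HT.
Qed.

Lemma guided_path : exists f, infinite_path f T.
Proof.
  assert (U : forall i s t j, guided s (i + 1) -> guided t (i + 1) ->
      (seq_entry s i j <-> seq_entry t i j)).
  { intros i s t j Hs Ht.
    apply (guided_coherent s t (i + 1) (i + 1)); auto using lt_one_succ. }
  destruct (rel_comprehension (fun i j => exists s, guided s (i + 1) /\ seq_entry s i j))
    as (f & Ef & Sf).
  (* Guided sequences exist at every length and agree, so a missing entry is also witnessed by some
     guided sequence, and the complement is Sigma^0_1. *)
  { split; [unfold guided; definable|].
    apply (Sigma1_ext (fun e => exists s, guided s (e 1%nat + 1) /\
      ~ seq_entry s (e 1%nat) (e 0%nat))); [|unfold guided; definable].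
    intros e. split.
    - intros (s & Hs & N) (t & Ht & H). now apply N, (U _ t s).
    - intros N. destruct (guided_exists (e 1%nat + 1)) as [s Hs]. exists s.
      split; [exact Hs|]. intros H. apply N. now exists s. }
  exists f. split; [split|].
  - intros z Hz. destruct (Sf z Hz) as (i & j & ->).
    apply Ef in Hz as (s & ([_ Bs] & _) & Hj). exists i, j. eauto.
  - intros i _. destruct (guided_exists (i + 1)) as [s Hs].
    pose proof Hs as ([(_ & _ & F & _) _] & Ls & _).
    destruct (proj1 (Ls i) (lt_one_succ i)) as [j Hj]. exists j. split.
    + apply Ef. now exists s.
    + intros j' Hj'. apply Ef in Hj' as (t & Ht & Hj'). apply (F i); [exact Hj|].
      now apply (U i t s).
  - intros l. destruct (guided_exists l) as [s Hs]. pose proof Hs as (Bs & Ls & _).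
    exists s. split; [now apply (guided_in_tree s l)|]. split; [apply Bs|].
    split; [exact Ls|]. intros i j Hi. unfold maps_to. rewrite Ef. split.
    + intros Hj. destruct (guided_exists (i + 1)) as [t Ht]. exists t. split; [exact Ht|].
      apply (guided_coherent s t l (i + 1)); auto using lt_one_succ.
    + intros (t & Ht & Hj).
      apply (guided_coherent s t l (i + 1)); auto using lt_one_succ.
Qed.

End Path.

Lemma separation_WKL : separation_principle -> weak_Konig_lemma M.
Proof.
  intros Sep T HT IT.
  destruct (Sigma1_separation (forces (T := T) 1 0) (forces (T := T) 0 1)) as [S HS]; auto.
  - unfold forces, extends_below. definable.
  - unfold forces, extends_below. definable.
  - intros r. now apply forces_disjoint.
  - now apply (guided_path HT IT (S := S)).
Qed.

End Separation.

(** * From compatible orders to the equivalences *)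

Section Equivalence.

Context {M : L2_structure} {HM : RCA0 M}.
Implicit Types (P leP : set M).

Lemma proper_1_1_compatible P leP :
  proper_1_1_interval_order P leP -> exists R, compatible_order P leP R.
Proof.
  intros (L & leL & F & HL & HF & i1 & i2 & i3 & i4).
  exact (interval_1_1_compatible HL HF i1 i2 i4 i3).
Qed.

Lemma proper_interval_forbidden P leP : partial_order P leP ->
  proper_interval_order P leP -> no_2_plus_2 leP /\ no_3_plus_1 P leP.
Proof.
  intros HP (L & leL & F & HL & HF & i1 & i2 & i4). split.
  - exact (interval_no_2_plus_2 HL HF i2 HP).
  - exact (interval_no_3_plus_1 HL HF i1 i2 i4 HP).
Qed.

(** The orders considered are closed and proper at once, a class to which each of the statements
    (ii) to (v) applies, so all four reversals pass through here. *)
Lemma compatible_WKL :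
  (forall P leP, partial_order P leP -> closed_interval_order P leP ->
     proper_interval_order P leP -> exists R, compatible_order P leP R) ->
  weak_Konig_lemma M.
Proof.
  intros H. apply separation_WKL. intros A B AB.
  destruct (is_gadget_exists A B) as (P & leP & HG).
  destruct (H P leP) as [R C].
  - apply HG.
  - exact (gadget_closed A B HG).
  - exact (gadget_proper A B AB HG).
  - exact (gadget_separation A B HG R C).
Qed.

End Equivalence.

Theorem theorem6p22 :
  forall M : L2_structure, RCA0 M ->
    (WKL0 M <->
       (forall P leP : set M, partial_order P leP ->
          no_2_plus_2 leP -> no_3_plus_1 P leP ->
          proper_1_1_interval_order P leP)) /\
    (WKL0 M <->
       (forall P leP : set M, partial_order P leP ->
          no_2_plus_2 leP -> no_3_plus_1 P leP ->
          proper_closed_interval_order P leP)) /\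
    (WKL0 M <->
       (forall P leP : set M, partial_order P leP ->
          proper_interval_order P leP ->
          proper_1_1_interval_order P leP)) /\
    (WKL0 M <->
       (forall P leP : set M, partial_order P leP ->
          closed_interval_order P leP -> proper_interval_order P leP ->
          proper_closed_interval_order P leP)).
Proof.
  intros M HM.
  assert (W1 : WKL0 M -> forall P leP : set M, partial_order P leP ->
      no_2_plus_2 leP -> no_3_plus_1 P leP -> proper_1_1_interval_order P leP).
  { intros [_ WKL] P leP HP H22 H31. destruct (WKL_compatible HP H22 H31 WKL) as [R C].
    exact (compatible_proper_1_1 P leP R HP C). }
  assert (W2 : WKL0 M -> forall P leP : set M, partial_order P leP ->
      no_2_plus_2 leP -> no_3_plus_1 P leP -> proper_closed_interval_order P leP).
  { intros [_ WKL] P leP HP H22 H31. destruct (WKL_compatible HP H22 H31 WKL) as [R C].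
    exact (compatible_proper_closed P leP R HP C). }
  split; [|split; [|split]]; split.
  - exact W1.
  - intros H. split; [exact HM|]. apply compatible_WKL. intros P leP HP _ Hpr.
    destruct (proper_interval_forbidden P leP HP Hpr).
    apply proper_1_1_compatible. now apply H.
  - exact W2.
  - intros H. split; [exact HM|]. apply compatible_WKL. intros P leP HP _ Hpr.
    destruct (proper_interval_forbidden P leP HP Hpr).
    apply proper_closed_compatible. now apply H.
  - intros W P leP HP Hpr. destruct (proper_interval_forbidden P leP HP Hpr).
    now apply W1.
  - intros H. split; [exact HM|]. apply compatible_WKL. intros P leP HP _ Hpr.
    apply proper_1_1_compatible. now apply H.
  - intros W P leP HP _ Hpr. destruct (proper_interval_forbidden P leP HP Hpr).
    now apply W2.
  - intros H. split; [exact HM|]. apply compatible_WKL. intros P leP HP Hcl Hpr.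
    apply proper_closed_compatible. now apply H.
Qed.
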